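(* Let $(M,c)$ be a Riemannian conformal structure on a manifold $M$ of dimension $n\geq 2$. Fix a metric $g\in c$ and an admissible smooth $1$-parameter family $\alpha\colon \mathbb{R}\to\mathcal{T}_{(1,1)}M$ such that $\mathrm{trace}(\dot\alpha(0))=\frac{\mathrm{scal}^{g}}{n-1}$. For $u\in C^\infty(M)$ let $\Psi^u\colon M\to(\widetilde M,\widetilde g)$, $\Psi^u(x)=(e^{u(x)},0,x)$, be the associated spacelike immersion (with induced metric $e^{2u}g$) into the Lorentzian manifold $(\widetilde M,\widetilde g)$ constructed from $g$ and $\alpha$, and let $A_{\eta^u}$ be the Weingarten endomorphism of the lightlike normal vector field $\eta^u$ along $\Psi^u$. Then the assignment $$D\colon c\to\mathcal{T}_{(0,2)}M,\qquad e^{2u}g\mapsto e^{2u}g\big(A_{\eta^u}(-),-\big)$$ defines a Möbius structure for the Riemannian conformal structure $(M,c)$.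
   Context: Manifolds are smooth, Hausdorff, second countable, without boundary. A Riemannian conformal structure $(M,c)$ is an equivalence class $c$ of Riemannian metrics on $M$, where $g\sim g'$ iff $g'=e^{2u}g$ for some $u\in C^\infty(M)$. $\mathcal{T}_{(r,s)}M$ denotes the tensor fields on $M$ of the given type; elements of $\mathcal{T}_{(1,1)}M$ are endomorphism fields of $TM$, and elements of $\mathcal{T}_{(0,2)}M$ are covariant 2-tensor fields. $\mathrm{scal}^g$ is the scalar curvature of $g$. Möbius structure. A Möbius structure for $(M,c)$ ($n=\dim M\ge 2$) is a map $D\colon c\to\mathcal{T}_{(0,2)}M$ such that (1) for every $g\in c$, $D(g)$ is symmetric and $\mathrm{trace}_gD(g)=\frac{\mathrm{scal}^g}{2(n-1)}$; (2) for every $g\in c$ and $u\in C^\infty(M)$, $D(e^{2u}g)=D(g)-\frac{\|\nabla^gu\|_g^2}{2}g-\mathrm{Hess}^g(u)+du\otimes du$, where $\nabla^g u$ is the $g$-gradient and $\mathrm{Hess}^g(u)$ the $g$-Hessian. Admissible family. A smooth $1$-parameter family $\alpha\colon\mathbb{R}\to\mathcal{T}_{(1,1)}M$ (with derivative $\dot\alpha(\rho)$ in $\rho$) is admissible if each $\alpha(\rho)$ is self-adjoint with respect to any $g\in c$, $\alpha(0)=\mathrm{Id}$, and there is $\delta>0$ such that $\alpha(\rho)$ is nonsingular for $|\rho|<\delta$. Construction. Given $g\in c$ and an admissible $\alpha$, with $\delta>0$ such that $\alpha(\rho)$ is nonsingular for $|\rho|<\delta$, let $\widetilde M=\mathbb{R}^+\times(-\delta,\delta)\times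 M$ with coordinates $(t,\rho)$ on the first two factors, and let $\widetilde g$ be the Lorentzian metric $$\widetilde g=d(\rho t)\otimes dt+dt\otimes d(\rho t)+t^2\,g(\alpha(\rho)(-),-).$$ For $u\in C^\infty(M)$ the immersion $\Psi^u(x)=(e^{u(x)},0,x)$ is spacelike with $(\Psi^u)^*\widetilde g=e^{2u}g$. Its lightlike normal field $\eta^u$ is $$\eta^u=e^{-u}\tfrac{\|\nabla^gu\|_g^2}{2}\,\partial_t|_{\Psi^u}-e^{-2u}\partial_\rho|_{\Psi^u}+e^{-2u}\nabla^gu|_{\Psi^u},$$ where a vector field on $M$ is identified with its natural lift to $\widetilde M$ and $X|_{\Psi^u}=X\circ\Psi^u$. The Weingarten endomorphism $A_\eta$ of a normal field $\eta$ is defined by $(\widetilde\nabla_V\eta)^\top=-T\Psi^u\cdot A_\eta V$ for $V\in\mathfrak{X}(M)$, where $\widetilde\nabla$ is (induced by) the Levi-Civita connection of $\widetilde g$ and $\top$ denotes the tangential part. *)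

(* Defs.v *)
From HB Require Import structures.
From mathcomp Require Import all_boot all_order all_algebra.
From mathcomp Require Import all_classical all_reals all_analysis.

Set Implicit Arguments.
Unset Strict Implicit.
Unset Printing Implicit Defensive.

Import Order.TTheory GRing.Theory Num.Theory.
Import numFieldNormedType.Exports.

Local Open Scope classical_set_scope.
Local Open Scope ring_scope.

(* Conventions. Tangent vectors are row vectors, so that an endomorphism with
   matrix B acts by v |-> v *m B, a bilinear form with matrix S is
   (v, w) |-> v *m S *m w^T, and the tangent map of F is v |-> v *m 'J F x. *)

Section Calculus.
Context {R : realType}.

Definition pd n (k : 'I_n) (f : 'rV[R]_n -> R) : 'rV[R]_n -> R :=
  fun x => 'D_(delta_mx 0 k) f x.

Fixpoint times_differentiable n (k : nat) (U : set 'rV[R]_n)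
    (f : 'rV[R]_n -> R) : Prop :=
  if k is k'.+1 then
    (forall x, U x -> differentiable f x) /\
    (forall a, times_differentiable k' U (pd a f))
  else True.

(* Only used for open U. *)
Definition smooth_on n (U : set 'rV[R]_n) (f : 'rV[R]_n -> R) : Prop :=
  forall k, times_differentiable k U f.

Definition smooth_mx_on n p q (U : set 'rV[R]_n)
    (F : 'rV[R]_n -> 'M[R]_(p, q)) : Prop :=
  forall a b, smooth_on U (fun x => F x a b).

Definition dfun n (f : 'rV[R]_n -> R) (x : 'rV[R]_n) : 'rV[R]_n :=
  \row_k pd k f x.

End Calculus.

Section LocalGeometry.
Context {R : realType} {n : nat}.
Variable G : 'rV[R]_n -> 'M[R]_n.

(* christoffel x k a b is Gamma^k_{ab} of the Levi-Civita connection of G. *)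
Definition christoffel (x : 'rV[R]_n) (k a b : 'I_n) : R :=
  2^-1 * \sum_l invmx (G x) k l *
    (pd a (fun y => G y b l) x + pd b (fun y => G y a l) x
     - pd l (fun y => G y a b) x).

(* Ric(Y, Z) = trace (X |-> nabla_X nabla_Y Z - nabla_Y nabla_X Z
                           - nabla_[X,Y] Z); round spheres have scal > 0. *)
Definition ricci (x : 'rV[R]_n) : 'M[R]_n :=
  \matrix_(b, c) \sum_a
    (pd a (fun y => christoffel y a b c) x
     - pd b (fun y => christoffel y a a c) x
     + \sum_m (christoffel x a a m * christoffel x m b c
               - christoffel x a b m * christoffel x m a c)).

Definition trace_wrt (x : 'rV[R]_n) (S : 'M[R]_n) : R := \tr (invmx (G x) *m S).

Definition scalar_curvature (x : 'rV[R]_n) : R := trace_wrt x (ricci x).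

Definition grad (f : 'rV[R]_n -> R) (x : 'rV[R]_n) : 'rV[R]_n :=
  dfun f x *m invmx (G x).

Definition sqnorm (x v : 'rV[R]_n) : R := (v *m G x *m v^T) 0 0.

Definition hess (f : 'rV[R]_n -> R) (x : 'rV[R]_n) : 'M[R]_n :=
  \matrix_(a, b) (pd a (pd b f) x - \sum_k christoffel x k a b * pd k f x).

(* For F with values in the domain of G and v a vector field along F:
   the derivative of v in the direction w, for the connection induced along F
   by the Levi-Civita connection of G. *)
Definition cov_deriv m (F v : 'rV[R]_m -> 'rV[R]_n) (x w : 'rV[R]_m)
    : 'rV[R]_n :=
  w *m 'J v x +
  \row_k \sum_a \sum_b
    christoffel (F x) k a b * (w *m 'J F x) 0 a * v x 0 b.

(* P is the tangential part of W at F x. *)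
Definition is_tangential_part m (F : 'rV[R]_m -> 'rV[R]_n) (x : 'rV[R]_m)
    (W P : 'rV[R]_n) : Prop :=
  (P <= 'J F x)%MS /\ forall w : 'rV[R]_m, (W - P) *m G (F x) *m (w *m 'J F x)^T = 0.

End LocalGeometry.


(* [crd] is meaningful on [dom], [par] on [crd @` dom]. *)
Record chart (R : realType) (T : Type) (n : nat) := Chart {
  dom : set T;
  crd : T -> 'rV[R]_n;
  par : 'rV[R]_n -> T
}.

Definition cran (R : realType) (T : Type) n (phi : chart R T n)
  : set 'rV[R]_n := crd phi @` dom phi.

Section Manifold.
Context {R : realType} {T : Type} {n : nat} {I : Type}.
Variable A : I -> chart R T n.

Definition transition (i j : I) (x : 'rV[R]_n) : 'rV[R]_n :=
  crd (A j) (par (A i) x).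

Definition overlap (i j : I) : set 'rV[R]_n :=
  [set x | cran (A i) x /\ dom (A j) (par (A i) x)].

(* Expression of a function in the coordinates of the i-th chart. *)
Definition loc (u : T -> R) (i : I) (x : 'rV[R]_n) : R := u (par (A i) x).

Definition smooth_fun (u : T -> R) : Prop :=
  forall i, smooth_on (cran (A i)) (loc u i).

End Manifold.

Record smooth_manifold (R : realType) (T : topologicalType) (n : nat)
    (I : Type) (A : I -> chart R T n) : Prop := SmoothManifold {
  mfd_hausdorff : hausdorff_space T;
  mfd_countable : @second_countable T;
  mfd_cover : forall p, exists i, dom (A i) p;
  mfd_dom_open : forall i, open (dom (A i));
  mfd_cran_open : forall i, open (cran (A i));
  mfd_crdK : forall i p, dom (A i) p -> par (A i) (crd (A i) p) = p;
  mfd_crd_cont : forall i, {within dom (A i), continuous (crd (A i))};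
  mfd_par_cont : forall i, {within cran (A i), continuous (par (A i))};
  mfd_transition : forall i j, smooth_mx_on (overlap A i j) (transition A i j)
}.

(* Components of a tensor field with two indices: one matrix-valued function of
   the coordinates for each chart. They are required to vanish outside the
   coordinate range, so that equality of fields is Leibniz equality. *)
Definition tfield (R : realType) (n : nat) (I : Type) :=
  I -> 'rV[R]_n -> 'M[R]_n.

Section Tensors.
Context {R : realType} {T : Type} {n : nat} {I : Type}.
Variable A : I -> chart R T n.

Definition smooth_field (S : tfield R n I) : Prop :=
  (forall i, smooth_mx_on (cran (A i)) (S i)) /\
  (forall i x, ~ cran (A i) x -> S i x = 0).

Definition tensor02 (S : tfield R n I) : Prop :=
  smooth_field S /\
  forall i j x, overlap A i j x ->
    S i x = 'J (transition A i j) x *m S j (transition A i j x)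
            *m ('J (transition A i j) x)^T.

Definition tensor11 (B : tfield R n I) : Prop :=
  smooth_field B /\
  forall i j x, overlap A i j x ->
    B i x *m 'J (transition A i j) x
    = 'J (transition A i j) x *m B j (transition A i j x).

Definition symmetric_field (S : tfield R n I) : Prop :=
  forall i x, cran (A i) x -> (S i x)^T = S i x.

(* The (0,2)-tensor field S(B(-), -). *)
Definition lower (S B : tfield R n I) : tfield R n I := fun i x => B i x *m S i x.


Definition riemannian_metric (g : tfield R n I) : Prop :=
  [/\ tensor02 g, symmetric_field g &
      forall i x, cran (A i) x ->
        forall v : 'rV[R]_n, v != 0 -> 0 < (v *m g i x *m v^T) 0 0].

Definition conf (g : tfield R n I) (u : T -> R) : tfield R n I :=
  fun i x => expR (2 * loc A u i x) *: g i x.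

Definition conformal_structure (c : set (tfield R n I)) : Prop :=
  exists2 g0, riemannian_metric g0 &
    c = [set h | exists2 u, smooth_fun A u & h = conf g0 u].

Record moebius_structure (c : set (tfield R n I))
    (D : tfield R n I -> tfield R n I) : Prop := MoebiusStructure {
  moebius_tensor : forall g, c g -> tensor02 (D g);
  moebius_sym : forall g, c g -> symmetric_field (D g);
  moebius_trace : forall g, c g -> forall i x, cran (A i) x ->
    trace_wrt (g i) x (D g i x)
    = scalar_curvature (g i) x / (2 * (n%:R - 1));
  moebius_conf : forall g u, c g -> smooth_fun A u ->
    forall i x, cran (A i) x ->
    let ui := loc A u i in
    D (conf g u) i x
    = D g i x - (sqnorm (g i) x (grad (g i) ui x) / 2) *: g i x
      - hess (g i) ui x + (dfun ui x)^T *m dfun ui x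
}.


Definition smooth_family (alpha : R -> tfield R n I) : Prop :=
  (forall r, tensor11 (alpha r)) /\
  forall i, smooth_mx_on [set y : 'rV[R]_(1 + n) | cran (A i) (rsubmx y)]
    (fun y => alpha (lsubmx y 0 0) i (rsubmx y)).

Definition family_deriv (alpha : R -> tfield R n I) (r : R) : tfield R n I :=
  fun i x => \matrix_(a, b) derive1 (fun s => alpha s i x a b) r.

Definition nonsingular_below (alpha : R -> tfield R n I) (delta : R) : Prop :=
  forall r, `|r| < delta ->
    forall i x, cran (A i) x -> alpha r i x \in unitmx.

Record admissible (c : set (tfield R n I)) (alpha : R -> tfield R n I)
    : Prop := Admissible {
  adm_smooth : smooth_family alpha;
  adm_selfadj : forall r h, c h -> forall i x, cran (A i) x ->
    alpha r i x *m h i x = h i x *m (alpha r i x)^T;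
  adm_id : forall i x, cran (A i) x -> alpha 0 i x = 1%:M;
  adm_nonsing : exists2 delta, 0 < delta & nonsingular_below alpha delta
}.

End Tensors.

Section Weingarten.
Context {R : realType} {T T' : Type} {n m : nat} {I J : Type}.
Variables (A : I -> chart R T n) (A' : J -> chart R T' m).

(* gt is a metric on the second manifold, F a map between the manifolds, and
   eta j p the components, in the j-th chart, of a vector at F p.
   B is A_eta: (nabla_w eta)^tangential = - TF (B w) for all w. *)
Definition is_weingarten (gt : tfield R m J) (F : T -> T')
    (eta : J -> T -> 'rV[R]_m) (B : tfield R n I) : Prop :=
  tensor11 A B /\
  forall i j x, cran (A i) x -> dom (A' j) (F (par (A i) x)) ->
    let Fij := fun z => crd (A' j) (F (par (A i) z)) in
    let etaij := fun z => eta j (par (A i) z) in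
    forall w : 'rV[R]_n,
      is_tangential_part (gt j) Fij x
        (cov_deriv (gt j) Fij etaij x w) (- (w *m B i x *m 'J Fij x)).

End Weingarten.

Section Ambient.
Context {R : realType} {T : Type} {n : nat} {I : Type}.
Variable A : I -> chart R T n.

(* The underlying set is the union of the chart domains in R * R * T. *)
Definition amb_chart (delta : R) (i : I) : chart R (R * R * T) (1 + (1 + n)) :=
  Chart
    [set p | [/\ 0 < p.1.1, - delta < p.1.2 < delta & dom (A i) p.2]]
    (fun p => row_mx p.1.1%:M (row_mx p.1.2%:M (crd (A i) p.2)))
    (fun y => (lsubmx y 0 0, lsubmx (rsubmx y) 0 0,
               par (A i) (rsubmx (rsubmx y)))).

Definition t_crd (y : 'rV[R]_(1 + (1 + n))) : R := lsubmx y 0 0.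
Definition rho_crd (y : 'rV[R]_(1 + (1 + n))) : R := lsubmx (rsubmx y) 0 0.
Definition M_crd (y : 'rV[R]_(1 + (1 + n))) : 'rV[R]_n := rsubmx (rsubmx y).

Definition d_t : 'rV[R]_(1 + (1 + n)) := row_mx 1%:M 0.
Definition d_rho : 'rV[R]_(1 + (1 + n)) := row_mx 0 (row_mx 1%:M 0).
Definition lift_vec (v : 'rV[R]_n) : 'rV[R]_(1 + (1 + n)) :=
  row_mx 0 (row_mx 0 v).

Definition otimes k (w1 w2 : 'rV[R]_k) : 'M[R]_k := w1^T *m w2.

Definition amb_metric (g : tfield R n I) (alpha : R -> tfield R n I)
    : tfield R (1 + (1 + n)) I :=
  fun i y =>
    let drhot := dfun (fun z => rho_crd z * t_crd z) y in
    let dt := dfun t_crd y in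
    otimes drhot dt + otimes dt drhot
    + t_crd y ^+ 2 *:
        block_mx 0 0 0
          (block_mx 0 0 0 (lower g (alpha (rho_crd y)) i (M_crd y))).

Definition Psi (u : T -> R) (p : T) : R * R * T := (expR (u p), 0, p).

Definition eta (g : tfield R n I) (u : T -> R) (i : I) (p : T)
    : 'rV[R]_(1 + (1 + n)) :=
  let gradu := grad (g i) (loc A u i) (crd (A i) p) in
  (expR (- u p) * (sqnorm (g i) (crd (A i) p) gradu / 2)) *: d_t
  - expR (- (2 * u p)) *: d_rho
  + expR (- (2 * u p)) *: lift_vec gradu.

(* The graph of e^{2u} g |-> e^{2u} g (A_{eta^u}(-), -). *)
Definition weingarten_assignment (g : tfield R n I) (alpha : R -> tfield R n I)
    (delta : R) (h S : tfield R n I) : Prop :=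
  exists u B,
    [/\ smooth_fun A u, h = conf A g u,
        is_weingarten A (amb_chart delta) (amb_metric g alpha)
          (Psi u) (eta g u) B
      & S = lower h B].

End Ambient.

(* Main.v *)
(** In a chart, write [G] for [g], [h] for [rho |-> g(alpha(rho)-,-)] and put
    [t = e^u].  Pairing the covariant derivative of [eta^u] with the tangent
    vectors of the immersion only involves first derivatives of the ambient
    metric at [rho = 0], where [h(0) = G], and everything collapses to
      [e^{2u} g(A_eta -, -) = h'(0)/2 - |grad u|^2/2 G - Hess u + du (x) du].
    The right-hand side is a symmetric tensor because [Hess u] is; its trace is
    the prescribed one by [trace alpha'(0) = scal/(n-1)] and the classical
    formula for the scalar curvature of [e^{2u} G]; and the conformal rule
    follows from [Hess^{e^{2u}G} v = Hess v - du (x) dv - dv (x) du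
    + <du, dv> G].  Since [u] is determined by [e^{2u} g], this defines [D]. *)

Require Import Defs.
From mathcomp Require Import all_boot all_order all_algebra.
From mathcomp Require Import all_classical all_reals all_analysis.
From mathcomp Require Import ring.

Set Implicit Arguments.
Unset Strict Implicit.
Unset Printing Implicit Defensive.

Import Order.TTheory GRing.Theory Num.Theory.
Import numFieldNormedType.Exports.
Local Open Scope classical_set_scope.
Local Open Scope ring_scope.

(** * Smooth functions of several variables *)

(** In the Weingarten equation the chart [i] of [M] and the chart [j] of the ambient space are
    independent. For the pair (i, j) the immersion is its expression over chart [j] precomposed with
    the transition map, so one computation in a single chart serves all pairs and ambient
    coordinates are never changed. The price is that the right-hand side of the formula must itself
    be shown to transform as a tensor, which rests on the transformation law of the Hessian. No
    derivative of an inverse metric is ever computed. Christoffel symbols are paired with vectors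
    until only symbols of the first kind remain, and derivatives of the gradient [w] are obtained by
    differentiating [du = G w]. In particular the ambient Christoffel symbols are never written out.
    The Weingarten endomorphism is given by a relation. It is solved by raising an index with the
    induced metric [e^{2u} g], and the solution is unique because that metric is nondegenerate; one
    identity for the defect of an arbitrary endomorphism yields both. *)

Section Differentiability.
Context {R : realType}.

Lemma near_eq_differentiable (V W : normedModType R) (f g : V -> W) (x : V) :
  (\near x, f x = g x) -> differentiable f x -> differentiable g x.
Proof.
move=> fg df; have [dfc dxf] := (diff_locallyP x f).1 df.
have gE : g \o shift x = cst (g x) + 'd f x +o_ 0 id.
  rewrite -(nbhs_singleton fg); apply/eqaddoP => _/posnumP[e].
  have /eqaddoP/(_ _ [gt0 of e%:num]) := dxf.
  apply: filterS2.
    move=> y /= E H; have Ey : f (y + x) = g (y + x) by exact: E.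
    by rewrite !fctE /= -Ey in H *; exact: H.
  have := fg; rewrite (near_shift 0) subr0; apply: filterS => y /=.
  by [].
(* The expansion of [f] is now one of [g] with the same linear part, which uniqueness identifies
   with the differential of [g]. *)
apply/diff_locallyP; have -> : ('d g x : V -> W) = 'd f x by exact: diff_unique.
by split.
Qed.

Lemma differentiable_rV (V : normedModType R) n (F : V -> 'rV[R]_n) (x : V) :
  (forall b, differentiable (fun y => F y 0 b) x) -> differentiable F x.
Proof.
move=> dF.
have -> : F = \sum_(b < n) (fun y => F y 0 b *: delta_mx 0 b).
  apply/funext => y; rewrite fct_sumE {1}(row_sum_delta (F y)).
  by [].
by apply: differentiable_sum => b; apply: differentiableZl.
Qed.

End Differentiability.

Section PartialDerivatives.
Context {R : realType} {n : nat}.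
Implicit Types (f g : 'rV[R]_n -> R) (x : 'rV[R]_n) (a : 'I_n).

Lemma near_eq_pd f g x a : (\near x, f x = g x) -> pd a f x = pd a g x.
Proof. exact: near_eq_derive. Qed.

Lemma pdE a f x : differentiable f x -> pd a f x = 'd f x (delta_mx 0 a).
Proof. exact: deriveE. Qed.

Lemma derive_sum_pd f x v : differentiable f x ->
  'D_v f x = \sum_a v 0 a * pd a f x.
Proof.
move=> df; rewrite deriveE// {1}(row_sum_delta v) linear_sum.
by apply: eq_bigr => a _; rewrite linearZ pdE.
Qed.

Lemma pd_cst a (k : R) x : pd a (fun=> k) x = 0.
Proof. exact: derive_cst. Qed.

Lemma pdD a f g x : differentiable f x -> differentiable g x ->
  pd a (fun y => f y + g y) x = pd a f x + pd a g x.
Proof. by move=> /diff_derivable df /diff_derivable dg; exact: deriveD. Qed.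

Lemma pdN a f x : differentiable f x -> pd a (fun y => - f y) x = - pd a f x.
Proof. by move=> /diff_derivable df; exact: deriveN. Qed.

Lemma pdB a f g x : differentiable f x -> differentiable g x ->
  pd a (fun y => f y - g y) x = pd a f x - pd a g x.
Proof. by move=> /diff_derivable df /diff_derivable dg; exact: deriveB. Qed.

Lemma pdM a f g x : differentiable f x -> differentiable g x ->
  pd a (fun y => f y * g y) x = pd a f x * g x + f x * pd a g x.
Proof.
move=> /diff_derivable df /diff_derivable dg.
by rewrite /pd (deriveM (df _) (dg _)) addrC /GRing.scale /= [g x * _]mulrC.
Qed.

Lemma differentiableMf f g x : differentiable f x -> differentiable g x ->
  differentiable (fun y => f y * g y) x.
Proof. exact: differentiableM. Qed.

Lemma differentiableDf f g x : differentiable f x -> differentiable g x ->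
  differentiable (fun y => f y + g y) x.
Proof. exact: differentiableD. Qed.

Lemma differentiableNf f x : differentiable f x ->
  differentiable (fun y => - f y) x.
Proof. exact: differentiableN. Qed.

Lemma differentiable_cstf (k : R) x : differentiable (fun _ : 'rV[R]_n => k) x.
Proof. exact: differentiable_cst. Qed.

Lemma differentiable_sumf (J : Type) (r : seq J) (P : pred J)
    (F : J -> 'rV[R]_n -> R) x : (forall j, differentiable (F j) x) ->
  differentiable (fun y => \sum_(j <- r | P j) F j y) x.
Proof.
move=> dF; elim: r => [|j r IH].
  by under eq_fun do rewrite big_nil; exact: differentiable_cstf.
under eq_fun do rewrite big_cons; case: (P j) => //.
exact: differentiableDf.
Qed.

Lemma pd_sum (J : Type) (r : seq J) (P : pred J)
    (F : J -> 'rV[R]_n -> R) x a : (forall j, differentiable (F j) x) ->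
  pd a (fun y => \sum_(j <- r | P j) F j y) x
  = \sum_(j <- r | P j) pd a (F j) x.
Proof.
move=> dF; elim: r => [|j r IH].
  by under eq_fun do rewrite big_nil; rewrite pd_cst big_nil.
under eq_fun do rewrite big_cons; rewrite big_cons; case: (P j) => //.
by rewrite pdD ?IH//; exact: differentiable_sumf.
Qed.

Lemma pdZ a (k : R) f x : differentiable f x ->
  pd a (fun y => k * f y) x = k * pd a f x.
Proof.
by move=> df; rewrite pdM// pd_cst mul0r add0r.
Qed.

Lemma differentiable_expR f x : differentiable f x ->
  differentiable (fun y => expR (f y)) x.
Proof.
move=> df; apply: (@differentiable_comp _ _ _ _ f expR) => //.
exact/derivable1_diffP.
Qed.

Lemma pd_expR a f x : differentiable f x ->
  pd a (fun y => expR (f y)) x = expR (f x) * pd a f x.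
Proof.
move=> df; have de : differentiable (expR : R -> R) (f x) by exact/derivable1_diffP.
rewrite pdE; last exact: differentiable_expR.
rewrite (@diff_comp _ _ _ _ f expR)// /= -pdE//.
rewrite -[pd a f x in LHS]mulr1 -[_ * 1]/(_ *: 1) linearZ /=.
by rewrite -deriveE// derive_val /GRing.scale /= mulrC.
Qed.

Lemma differentiable_inv f x : f x != 0 -> differentiable f x ->
  differentiable (fun y => (f y)^-1) x.
Proof. by move=> f0 df; apply: differentiableV. Qed.

Lemma pd_inv a f x : f x != 0 -> differentiable f x ->
  pd a (fun y => (f y)^-1) x = - (f x)^-1 * (f x)^-1 * pd a f x.
Proof.
move=> f0 /diff_derivable df; rewrite /pd (deriveV f0 (df _)).
by rewrite /GRing.scale /= !mulNr -invfM -expr2.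
Qed.

Lemma differentiable_sq f x : differentiable f x ->
  differentiable (fun y => f y ^+ 2) x.
Proof. by move=> df; under eq_fun do rewrite expr2; exact: differentiableMf. Qed.

End PartialDerivatives.

Section ChainRule.
Context {R : realType} {n m : nat}.

Lemma jacobianE (F : 'rV[R]_n -> 'rV[R]_m) x a b : differentiable F x ->
  'J F x a b = pd a (fun y => F y 0 b) x.
Proof.
move=> dF; rewrite /pd.
have := deriveEjacobian (delta_mx 0 a) dF; rewrite -rowE.
move=> /(congr1 (fun M : 'rV[R]_m => M 0 b)); rewrite [RHS]mxE => <-.
by rewrite derive_mx ?mxE//; exact: diff_derivable.
Qed.

Lemma differentiable_entry (F : 'rV[R]_n -> 'rV[R]_m) x b :
  differentiable F x -> differentiable (fun y => F y 0 b) x.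
Proof.
move=> dF; apply: (@differentiable_comp _ _ _ _ F (fun N => N 0 b)) => //.
exact: differentiable_coord.
Qed.

Lemma differentiable_compf (phi : 'rV[R]_n -> 'rV[R]_m) (f : 'rV[R]_m -> R) x :
  differentiable phi x -> differentiable f (phi x) ->
  differentiable (fun y => f (phi y)) x.
Proof. by move=> dp df; exact: (@differentiable_comp _ _ _ _ phi f). Qed.

Lemma pd_comp (phi : 'rV[R]_n -> 'rV[R]_m) (f : 'rV[R]_m -> R) x a :
  differentiable phi x -> differentiable f (phi x) ->
  pd a (fun y => f (phi y)) x = \sum_p 'J phi x a p * pd p f (phi x).
Proof.
move=> dp df; rewrite pdE; last exact: differentiable_compf.
rewrite (@diff_comp _ _ _ _ phi f)// /= -deriveE// derive_sum_pd//.
apply: eq_bigr => p _; congr (_ * _).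
by rewrite -deriveE// deriveEjacobian// -rowE mxE.
Qed.

End ChainRule.

Lemma jacobian_comp (R : realType) k m n (phi : 'rV[R]_k -> 'rV[R]_m)
    (F : 'rV[R]_m -> 'rV[R]_n) (x : 'rV[R]_k) :
  differentiable phi x -> differentiable F (phi x) ->
  'J (fun y => F (phi y)) x = 'J phi x *m 'J F (phi x).
Proof.
move=> dp dF; apply/matrixP => a b; rewrite jacobianE; last first.
  exact: (@differentiable_comp _ _ _ _ phi F).
rewrite (@pd_comp _ _ _ phi (fun z => F z 0 b))//; last exact: differentiable_entry.
by rewrite mxE; apply: eq_bigr => p _; rewrite [X in _ = _ * X]jacobianE.
Qed.

Lemma near_eq_jacobian (R : realType) m n (F H : 'rV[R]_m -> 'rV[R]_n)
    (x : 'rV[R]_m) :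
  (\near x, F x = H x) -> differentiable F x -> 'J F x = 'J H x.
Proof.
move=> FH dF; have dH : differentiable H x := near_eq_differentiable FH dF.
apply/matrixP => a b.
apply: (etrans (jacobianE a b dF) (etrans _ (esym (jacobianE a b dH)))).
by apply: near_eq_pd; apply: filterS FH => y ->.
Qed.

Section Smoothness.
Context {R : realType} {n : nat}.
Implicit Types (U : set 'rV[R]_n) (f g : 'rV[R]_n -> R).

Lemma near_open U f g (x : 'rV[R]_n) : open U -> U x ->
  (forall y, U y -> f y = g y) -> \near x, f x = g x.
Proof.
by move=> oU Ux fg; apply: filterS (open_nbhs_nbhs (conj oU Ux)).
Qed.

Lemma eq_pd_on U f g (x : 'rV[R]_n) a : open U -> U x ->
  (forall y, U y -> f y = g y) -> pd a f x = pd a g x.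
Proof. by move=> oU Ux fg; apply: near_eq_pd; exact: near_open fg. Qed.

(** Openness of [U] turns equality on [U] into equality near each point, which is all that partial
    derivatives see. *)
Lemma eq_times_differentiable k U f g : open U ->
  (forall y, U y -> f y = g y) ->
  times_differentiable k U f -> times_differentiable k U g.
Proof.
move=> oU; elim: k f g => // k IH f g fg [df dpf]; split=> [x Ux|a].
  exact: near_eq_differentiable (near_open oU Ux fg) (df x Ux).
by apply: IH (dpf a) => y Uy; exact: eq_pd_on fg.
Qed.

Lemma times_differentiableW k U f :
  times_differentiable k.+1 U f -> times_differentiable k U f.
Proof. by elim: k f => // k IH f [df dpf]; split=> // a; exact: IH. Qed.

Lemma eq_smooth_on U f g : open U -> (forall y, U y -> f y = g y) ->
  smooth_on U f -> smooth_on U g.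
Proof. by move=> oU fg sf k; exact: eq_times_differentiable fg (sf k). Qed.

Lemma smooth_differentiable U f x : smooth_on U f -> U x -> differentiable f x.
Proof. by move=> sf; exact: (sf 1%N).1. Qed.

Lemma smooth_pd U f a : smooth_on U f -> smooth_on U (pd a f).
Proof. by move=> sf k; exact: (sf k.+1).2. Qed.

Lemma smooth_cst U (c : R) : smooth_on U (fun=> c).
Proof.
move=> k; elim: k c => // k IH c; split=> [x _|a]; first exact: differentiable_cstf.
suff -> : pd a (fun=> c) = (fun=> 0 : R) by [].
by apply/funext => x; rewrite pd_cst.
Qed.

Lemma times_differentiableD k U f g : open U ->
  times_differentiable k U f -> times_differentiable k U g ->
  times_differentiable k U (fun y => f y + g y).
Proof.
move=> oU; elim: k f g => // k IH f g [df dpf] [dg dpg]; split=> [x Ux|a].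
  by apply: differentiableDf; [exact: df|exact: dg].
apply: (eq_times_differentiable oU _ (IH _ _ (dpf a) (dpg a))) => y Uy.
by rewrite pdD//; [exact: df|exact: dg].
Qed.

(** The Leibniz rule leaves one factor undifferentiated, and the induction needs that factor at the
    lower order, whence [times_differentiableW]. *)
Lemma times_differentiableM k U f g : open U ->
  times_differentiable k U f -> times_differentiable k U g ->
  times_differentiable k U (fun y => f y * g y).
Proof.
move=> oU; elim: k f g => // k IH f g sf sg; split=> [x Ux|a].
  by apply: differentiableMf; [exact: sf.1|exact: sg.1].
have H1 := IH _ _ (sf.2 a) (times_differentiableW sg).
have H2 := IH _ _ (times_differentiableW sf) (sg.2 a).
apply: (eq_times_differentiable oU _ (times_differentiableD oU H1 H2)) => y Uy.
by rewrite pdM//; [exact: sf.1|exact: sg.1].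
Qed.

Lemma smoothD U f g : open U -> smooth_on U f -> smooth_on U g ->
  smooth_on U (fun y => f y + g y).
Proof. by move=> oU sf sg k; exact: times_differentiableD. Qed.

Lemma smoothM U f g : open U -> smooth_on U f -> smooth_on U g ->
  smooth_on U (fun y => f y * g y).
Proof. by move=> oU sf sg k; exact: times_differentiableM. Qed.

Lemma smoothN U f : open U -> smooth_on U f -> smooth_on U (fun y => - f y).
Proof.
move=> oU sf; under eq_fun do rewrite -mulN1r.
by apply: smoothM => //; exact: smooth_cst.
Qed.

Lemma smoothB U f g : open U -> smooth_on U f -> smooth_on U g ->
  smooth_on U (fun y => f y - g y).
Proof. by move=> oU sf sg; apply: smoothD => //; exact: smoothN. Qed.

Lemma smooth_sum U (J : Type) (r : seq J) (P : pred J)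
    (F : J -> 'rV[R]_n -> R) : open U -> (forall j, smooth_on U (F j)) ->
  smooth_on U (fun y => \sum_(j <- r | P j) F j y).
Proof.
move=> oU sF; elim: r => [|j r IH].
  by under eq_fun do rewrite big_nil; exact: smooth_cst.
by under eq_fun do rewrite big_cons; case: (P j) => //; exact: smoothD.
Qed.

Lemma smooth_prod U (J : Type) (r : seq J) (P : pred J)
    (F : J -> 'rV[R]_n -> R) : open U -> (forall j, smooth_on U (F j)) ->
  smooth_on U (fun y => \prod_(j <- r | P j) F j y).
Proof.
move=> oU sF; elim: r => [|j r IH].
  by under eq_fun do rewrite big_nil; exact: smooth_cst.
by under eq_fun do rewrite big_cons; case: (P j) => //; exact: smoothM.
Qed.

(** Bootstrapping: a partial derivative is the exponential itself times one of [f], so order [k] of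
    the exponential gives order [k+1]. *)
Lemma smooth_expR U f : open U -> smooth_on U f ->
  smooth_on U (fun y => expR (f y)).
Proof.
move=> oU sf k; elim: k => // k IH; split=> [x Ux|a].
  exact/differentiable_expR/(smooth_differentiable sf).
apply: (eq_times_differentiable oU _
  (times_differentiableM oU IH (smooth_pd a sf k))) => y Uy.
by rewrite pd_expR//; exact: smooth_differentiable sf Uy.
Qed.

(** Bootstrapping as for the exponential: a derivative of the inverse is a polynomial in the inverse
    and a derivative of [f]. *)
Lemma smooth_inv U f : open U -> (forall y, U y -> f y != 0) ->
  smooth_on U f -> smooth_on U (fun y => (f y)^-1).
Proof.
move=> oU f0 sf k; elim: k => // k IH; split=> [x Ux|a].
  by apply: differentiable_inv; [exact: f0 | exact: smooth_differentiable sf Ux].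
have H := times_differentiableM oU (times_differentiableM oU IH IH)
  (smoothN oU (smooth_pd a sf) k).
apply: (eq_times_differentiable oU _ H) => y Uy.
by rewrite pd_inv ?mulrN ?mulNr ?f0//; exact: smooth_differentiable sf Uy.
Qed.

Lemma smooth_det U p (F : 'rV[R]_n -> 'M[R]_p) : open U ->
  smooth_mx_on U F -> smooth_on U (fun y => \det (F y)).
Proof.
move=> oU sF; apply: smooth_sum => // s; apply: smoothM => //.
  exact: smooth_cst.
by apply: smooth_prod => // i; exact: sF.
Qed.

Lemma smooth_mxM U p q r (F : 'rV[R]_n -> 'M[R]_(p, q))
    (G : 'rV[R]_n -> 'M[R]_(q, r)) : open U ->
  smooth_mx_on U F -> smooth_mx_on U G -> smooth_mx_on U (fun y => F y *m G y).
Proof.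
move=> oU sF sG a b; under eq_fun do rewrite mxE.
by apply: smooth_sum => // j; apply: smoothM.
Qed.

Lemma smooth_mxD U p q (F G : 'rV[R]_n -> 'M[R]_(p, q)) : open U ->
  smooth_mx_on U F -> smooth_mx_on U G -> smooth_mx_on U (fun y => F y + G y).
Proof. by move=> oU sF sG a b; under eq_fun do rewrite mxE; exact: smoothD. Qed.

Lemma smooth_mxN U p q (F : 'rV[R]_n -> 'M[R]_(p, q)) : open U ->
  smooth_mx_on U F -> smooth_mx_on U (fun y => - F y).
Proof. by move=> oU sF a b; under eq_fun do rewrite mxE; exact: smoothN. Qed.

Lemma smooth_mxZ U p q f (F : 'rV[R]_n -> 'M[R]_(p, q)) : open U ->
  smooth_on U f -> smooth_mx_on U F -> smooth_mx_on U (fun y => f y *: F y).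
Proof. by move=> oU sf sF a b; under eq_fun do rewrite mxE; exact: smoothM. Qed.

Lemma smooth_tr U p q (F : 'rV[R]_n -> 'M[R]_(p, q)) :
  smooth_mx_on U F -> smooth_mx_on U (fun y => (F y)^T).
Proof. by move=> sF a b; under eq_fun do rewrite mxE; exact: sF. Qed.

Lemma eq_smooth_mx_on U p q (F G : 'rV[R]_n -> 'M[R]_(p, q)) : open U ->
  (forall y, U y -> F y = G y) -> smooth_mx_on U F -> smooth_mx_on U G.
Proof.
by move=> oU FG sF a b; apply: (eq_smooth_on oU _ (sF a b)) => y Uy; rewrite FG.
Qed.

(** Cramer's rule: the entries are polynomials in those of [F], divided by the determinant. *)
Lemma smooth_invmx U p (F : 'rV[R]_n -> 'M[R]_p) : open U ->
  (forall y, U y -> F y \in unitmx) ->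
  smooth_mx_on U F -> smooth_mx_on U (fun y => invmx (F y)).
Proof.
move=> oU F1 sF.
suff H : smooth_mx_on U (fun y => (\det (F y))^-1 *: \adj (F y)).
  by apply: (eq_smooth_mx_on oU _ H) => y Uy; rewrite /invmx F1.
apply: smooth_mxZ => //.
  apply: smooth_inv => //; last exact: smooth_det.
  by move=> y /F1; rewrite unitmxE unitfE.
move=> a b; under eq_fun do rewrite mxE; apply: smoothM => //.
  exact: smooth_cst.
apply: smooth_det => // i j; under eq_fun do rewrite !mxE; exact: sF.
Qed.

End Smoothness.

(** * Symmetry of second derivatives *)

Section MixedDerivatives.
Context {R : realType} {V : normedModType R}.
Implicit Types (f : V -> R) (x v w : V).

Lemma is_derive_line f v x (s : R) : differentiable f (s *: v + x) ->
  is_derive s 1 (fun t : R => f (t *: v + x)) ('D_v f (s *: v + x)).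
Proof.
move=> df; pose l (t : R) := t *: v + x.
have dl : is_diff s l ( *:%R ^~ v).
  have -> : l = ( *:%R ^~ v) + cst x by [].
  by apply: is_diff_eq; rewrite addr0.
have dc : differentiable (f \o l) s by exact: differentiable_comp.
split; first exact: diff_derivable.
rewrite -[LHS]/('D_1 (f \o l) s) deriveE// diff_comp//= diff_val scale1r.
by rewrite deriveE.
Qed.

Definition second_difference f x v w (h : R) : R :=
  f (h *: v + (h *: w + x)) - f (h *: v + x) - (f (h *: w + x) - f x).

Lemma second_differenceC f x v w h :
  second_difference f x v w h = second_difference f x w v h.
Proof. by rewrite /second_difference addrCA; ring. Qed.

(* Twice the mean value theorem would need a continuous second derivative; one
   application followed by the differentiability of ['D_v f] at [x] does not. *)
Lemma second_difference_approx f x v w (e : R) : 0 < e ->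
  (\near x, differentiable f x) -> differentiable ('D_v f) x ->
  exists2 r, 0 < r & forall h, 0 < h < r ->
    `|second_difference f x v w h - h ^+ 2 * 'D_w ('D_v f) x| <= e * h ^+ 2.
Proof.
move=> e0 /nbhs_ballP[r0 /= r0_gt0 df] ddf.
(* The vectors [s v + h w] with [0 <= s <= h] have norm at most [h C]; the summand 1 keeps [C]
   positive when [v] and [w] vanish. *)
pose C := `|v| + `|w| + 1; have C0 : 0 < C by rewrite /C; apply: ltr_wpDl.
(* Two remainders of size [e' h C] will be multiplied by [h], and their total must not exceed
   [e h^2]. *)
pose e' := e / (2 * C); have e'0 : 0 < e' by rewrite divr_gt0// mulr_gt0.
pose g := 'D_v f.
have [r1 r1_gt0 Hg] : exists2 r1, 0 < r1 & forall k, `|k| < r1 ->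
    `|g (k + x) - g x - 'd g x k| <= e' * `|k|.
  have [_ /eqaddoP/(_ _ e'0)/nbhs_ballP[r1 /= r1_gt0 H]] := (diff_locallyP _ _).1 ddf.
  exists r1 => // k kr; have := H k.
  rewrite -ball_normE /= sub0r normrN => /(_ kr).
  by rewrite !fctE /= opprD addrA.
pose r := Num.min r0 r1 / C.
have r_gt0 : 0 < r by rewrite divr_gt0// lt_min r0_gt0.
exists r => // h /andP[h0 hr].
have hC : h * C < Num.min r0 r1 by rewrite -ltr_pdivlMr.
have norm1 (s : R) : 0 <= s -> s <= h -> `|s *: v| <= h * C.
  move=> s0 sh; rewrite normrZ ger0_norm// ler_pM//.
  by rewrite /C -addrA lerDl addr_ge0.
have norm2 (s : R) : 0 <= s -> s <= h -> `|s *: v + h *: w| <= h * C.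
  move=> s0 sh; apply: (le_trans (ler_normD _ _)).
  rewrite !normrZ (ger0_norm s0) (gtr0_norm h0) /C !mulrDr mulr1.
  by rewrite -[leLHS]addr0; apply: lerD (ltW h0); rewrite lerD2r ler_wpM2r.
have dfk k : `|k| <= h * C -> differentiable f (k + x).
  move=> kh; apply: df; rewrite -ball_normE /= opprD addrCA subrr addr0 normrN.
  by apply: le_lt_trans kh _; apply: lt_le_trans hC _; rewrite ge_min lexx.
have gk k : `|k| <= h * C -> `|g (k + x) - g x - 'd g x k| <= e' * (h * C).
  move=> kh; apply: le_trans (Hg k _) _.
    by apply: le_lt_trans kh _; apply: lt_le_trans hC _; rewrite ge_min lexx orbT.
  by rewrite ler_pM2l.
pose G (s : R) := f (s *: v + (h *: w + x)) - f (s *: v + x).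
pose dG (s : R) := g (s *: v + (h *: w + x)) - g (s *: v + x).
have dGP s : 0 <= s -> s <= h -> is_derive s 1 G (dG s).
  move=> s0 sh; apply: is_deriveB; apply: is_derive_line.
    by rewrite addrA; apply: dfk; exact: norm2.
  by apply: dfk; exact: norm1.
have [xi] : exists2 c, c \in `]0, h[%R & G h - G 0 = dG c * (h - 0).
  apply: MVT => //.
    by move=> s; rewrite in_itv /= => /andP[s0 sh]; apply: dGP; exact: ltW.
  apply: derivable_within_continuous => s; rewrite in_itv /= => /andP[s0 sh].
  by apply: ex_derive; exact: dGP.
rewrite in_itv /= subr0 => /andP[/ltW xi0 /ltW xih].
rewrite /G !scale0r !add0r -/(second_difference f x v w h) => ->.
rewrite deriveE// -/g.
(* Expanding [g] at both ends of the increment, the terms in [xi *: v] cancel and the linear part in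
   [w] is left. *)
have -> : dG xi * h - h ^+ 2 * 'd g x w =
    h * ((g (xi *: v + h *: w + x) - g x - 'd g x (xi *: v + h *: w))
         - (g (xi *: v + x) - g x - 'd g x (xi *: v))).
  have -> : 'd g x (xi *: v + h *: w) = 'd g x (xi *: v) + h * 'd g x w.
    by rewrite linearD; congr (_ + _); exact: linearZ.
  by rewrite /dG addrA; ring.
rewrite normrM gtr0_norm// mulrC expr2 mulrA ler_pM2r//.
apply: le_trans (ler_normB _ _) _.
apply: (@le_trans _ _ (e' * (h * C) + e' * (h * C))).
  by apply: lerD; apply: gk; [exact: norm2|exact: norm1].
have -> : e' * (h * C) + e' * (h * C) = e * h.
  by rewrite /e'; field; rewrite gt_eqF.
exact: lexx.
Qed.

(** The second difference is symmetric in [v] and [w], so for small [h] both iterated derivatives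
    times [h^2] lie within [(e/2) h^2] of the same number. *)
Lemma deriveC f x v w : (\near x, differentiable f x) ->
  differentiable ('D_v f) x -> differentiable ('D_w f) x ->
  'D_w ('D_v f) x = 'D_v ('D_w f) x.
Proof.
move=> df dv dw; apply/eqP; rewrite -subr_eq0 -normr_le0.
apply/ler_addgt0Pr => e e0; rewrite add0r.
have e2 : 0 < e / 2 by rewrite divr_gt0.
have [r1 r1_gt0 H1] := second_difference_approx w e2 df dv.
have [r2 r2_gt0 H2] := second_difference_approx v e2 df dw.
pose h := Num.min r1 r2 / 2.
have m0 : 0 < Num.min r1 r2 by rewrite lt_min r1_gt0.
have h0 : 0 < h by rewrite divr_gt0.
have hm : h < Num.min r1 r2 by rewrite /h ltr_pdivrMr// ltr_pMr// ltr1n.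
have h1 : 0 < h < r1 by rewrite h0 (lt_le_trans hm)// ge_min lexx.
have h2 : 0 < h < r2 by rewrite h0 (lt_le_trans hm)// ge_min lexx orbT.
have hh : 0 < h ^+ 2 by rewrite exprn_gt0.
rewrite -(ler_pM2r hh) -[X in _ * X]gtr0_norm// -normrM.
have {H1} := H1 _ h1; have {H2} := H2 _ h2; rewrite second_differenceC.
move: (second_difference _ _ _ _ _) ('D_w _ x) ('D_v _ x) => d p q H2 H1.
have -> : (p - q) * h ^+ 2 = (d - h ^+ 2 * q) - (d - h ^+ 2 * p) by ring.
apply: le_trans (ler_normB _ _) _; apply: le_trans (lerD H2 H1) _.
by rewrite -mulrDl -splitr.
Qed.

End MixedDerivatives.

Lemma pdC (R : realType) n (U : set 'rV[R]_n) (f : 'rV[R]_n -> R) x a b :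
  open U -> U x -> smooth_on U f -> pd a (pd b f) x = pd b (pd a f) x.
Proof.
move=> oU Ux sf; apply: deriveC.
- by apply: filterS (open_nbhs_nbhs (conj oU Ux)) => y; exact: smooth_differentiable.
- exact: smooth_differentiable (smooth_pd b sf) Ux.
- exact: smooth_differentiable (smooth_pd a sf) Ux.
Qed.

(** * Restriction to slices and composition with projections *)

Section AffineSlices.
Context {R : realType} {n m : nat}.
Variables (iota : 'rV[R]_n -> 'rV[R]_m) (sigma : 'I_n -> 'I_m).
Hypothesis iotaD : forall a (h : R) x,
  iota (h *: delta_mx 0 a + x) = h *: delta_mx 0 (sigma a) + iota x.

Lemma pd_slice (f : 'rV[R]_m -> R) x a :
  pd a (fun y => f (iota y)) x = pd (sigma a) f (iota x).
Proof. by rewrite /pd /derive /=; under eq_fun do rewrite iotaD. Qed.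

(** Since [iota] sends coordinate directions to coordinate directions, a partial derivative of the
    restriction is again the restriction of a partial derivative, and induction on the order
    applies. *)
Lemma smooth_slice (U : set 'rV[R]_n) (W : set 'rV[R]_m) (f : 'rV[R]_m -> R) :
  (forall x, differentiable iota x) -> (forall x, U x -> W (iota x)) ->
  smooth_on W f -> smooth_on U (fun x => f (iota x)).
Proof.
move=> di UW sf k; elim: k f sf => // k IH f sf; split=> [x Ux|a].
  by apply: differentiable_compf => //; exact: smooth_differentiable sf (UW _ Ux).
have -> : pd a (fun x => f (iota x)) = (fun x => pd (sigma a) f (iota x)).
  by apply/funext => x; exact: pd_slice.
by apply: IH; exact: smooth_pd.
Qed.

End AffineSlices.

Section LinearComposition.
Context {R : realType}.

(** The difference quotients of the two sides are the same function of the step. *)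
Lemma derive_linear_comp n m (L : 'rV[R]_n -> 'rV[R]_m) (f : 'rV[R]_m -> R) y v :
  (forall h, L (h *: v + y) = h *: L v + L y) ->
  'D_v (fun z => f (L z)) y = 'D_(L v) f (L y).
Proof. by move=> LE; rewrite /derive /=; under eq_fun do rewrite LE. Qed.

Lemma pd_rsubmx_rshift n m (f : 'rV[R]_m -> R) (y : 'rV[R]_(n + m)) j :
  pd (rshift n j) (fun z : 'rV[R]_(n + m) => f (rsubmx z)) y = pd j f (rsubmx y).
Proof.
have L h : rsubmx (h *: delta_mx 0 (rshift n j) + y) =
    h *: rsubmx (delta_mx 0 (rshift n j) : 'rV[R]_(n + m)) + rsubmx y.
  by apply/rowP => k; rewrite !mxE.
etransitivity; first exact: (derive_linear_comp (L := @rsubmx R 1 n m) f L).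
suff -> : rsubmx (delta_mx 0 (rshift n j) : 'rV[R]_(n + m)) = delta_mx 0 j by [].
by apply/rowP => k; rewrite !mxE /= (inj_eq (@rshift_inj _ _)).
Qed.

Lemma pd_rsubmx_lshift n m (f : 'rV[R]_m -> R) (y : 'rV[R]_(n + m)) j :
  pd (lshift m j) (fun z : 'rV[R]_(n + m) => f (rsubmx z)) y = 0.
Proof.
have L h : rsubmx (h *: delta_mx 0 (lshift m j) + y) =
    h *: rsubmx (delta_mx 0 (lshift m j) : 'rV[R]_(n + m)) + rsubmx y.
  by apply/rowP => k; rewrite !mxE.
etransitivity; first exact: (derive_linear_comp (L := @rsubmx R 1 n m) f L).
suff -> : rsubmx (delta_mx 0 (lshift m j) : 'rV[R]_(n + m)) = 0 by rewrite derive0.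
by apply/rowP => k; rewrite !mxE /= eq_rlshift.
Qed.

Lemma pd_coord n (k j : 'I_n) (x : 'rV[R]_n) :
  pd k (fun y => y 0 j) x = (j == k)%:R.
Proof.
rewrite pdE; last exact: differentiable_coord.
have @f : {linear 'rV[R]_n -> R}.
  by exists (fun N : 'rV[R]_n => N 0 j); do 2![eexists]; do ?[constructor];
     rewrite ?mxE// => ? *; rewrite ?mxE//; move=> ?; rewrite !mxE.
rewrite (_ : (fun y : 'rV[R]_n => y 0 j) = f) // diff_lin; last exact/coord_continuous.
by rewrite /f /= mxE.
Qed.

Lemma row_mx_line n (h s : R) (x : 'rV[R]_n) :
  h *: delta_mx 0 (lshift n ord0) + row_mx s%:M x
  = row_mx (h + s)%:M x :> 'rV[R]_(1 + n).
Proof.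
apply/rowP => k; rewrite mxE [X in X + _]mxE [X in _ * X + _]mxE.
case: (split_ordP k) => j ->; last by rewrite !row_mxEr eq_rlshift mulr0 add0r.
by rewrite !row_mxEl !ord1 !mxE !eqxx mulr1.
Qed.

Lemma pd_line n (f : 'rV[R]_(1 + n) -> R) (s : R) (x : 'rV[R]_n) :
  pd (lshift n ord0) f (row_mx s%:M x) = derive1 (fun r => f (row_mx r%:M x)) s.
Proof. by rewrite /pd /derive /=; under eq_fun do rewrite row_mx_line. Qed.

Lemma derivable_line n (f : 'rV[R]_(1 + n) -> R) (x : 'rV[R]_n) :
  differentiable f (row_mx 0%:M x) -> derivable (fun r => f (row_mx r%:M x)) 0 1.
Proof.
move=> df; have E : (fun r : R => f (row_mx r%:M x)) =
    (fun r => f (r *: delta_mx 0 (lshift n ord0) + row_mx 0%:M x)).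
  by apply/funext => r; rewrite row_mx_line addr0.
rewrite E; apply: ex_derive; apply: is_derive_line.
by rewrite row_mx_line addr0.
Qed.

Lemma open_rsubmx n m (U : set 'rV[R]_m) : open U ->
  open [set z : 'rV[R]_(n + m) | U (rsubmx z)].
Proof. by move=> oU; apply: open_comp => // z _; exact: continuous_rsubmx. Qed.

Lemma smooth_rsubmx n m (U : set 'rV[R]_m) (f : 'rV[R]_m -> R) :
  open U -> smooth_on U f ->
  smooth_on [set z : 'rV[R]_(n + m) | U (rsubmx z)] (fun z => f (rsubmx z)).
Proof.
move=> oU sf k; elim: k f sf => // k IH f sf; split=> [x /= Ux|a].
  apply: (@differentiable_comp _ _ _ _ (@rsubmx R 1 n m) f).
    exact: differentiable_rsubmx.
  exact: smooth_differentiable sf Ux.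
case: (split_ordP a) => j ->.
  have -> : pd (lshift m j) (fun z : 'rV[R]_(n + m) => f (rsubmx z)) = fun=> 0.
    by apply/funext => z; exact: pd_rsubmx_lshift.
  exact: smooth_cst.
have -> : pd (rshift n j) (fun z : 'rV[R]_(n + m) => f (rsubmx z)) =
    fun z => pd j f (rsubmx z).
  by apply/funext => z; exact: pd_rsubmx_rshift.
by apply: IH; exact: smooth_pd.
Qed.

End LinearComposition.

(** * The Levi-Civita connection in coordinates *)

Opaque pd jacobian.

Section FiniteSums.
Context {R : realType} {n : nat}.

Lemma sum_delta (F : 'I_n -> R) b : \sum_a (a == b)%:R * F a = F b.
Proof.
rewrite (bigD1 b)//= eqxx mul1r big1 ?addr0// => a /negbTE ->.
by rewrite mul0r.
Qed.

Lemma sum_deltaC (F : 'I_n -> R) b : \sum_a (b == a)%:R * F a = F b.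
Proof. by under eq_bigr do rewrite eq_sym; exact: sum_delta. Qed.

Lemma sum_invmx (A : 'M[R]_n) (F : 'I_n -> R) k : A \in unitmx ->
  \sum_l \sum_m invmx A k l * A l m * F m = F k.
Proof.
move=> A1; rewrite exchange_big /= -[RHS](sum_deltaC F); apply: eq_bigr => m _.
by rewrite -mulr_suml; have /matrixP/(_ k m) := mulVmx A1; rewrite !mxE => ->.
Qed.

Lemma sum_mx_inv (A : 'M[R]_n) (F : 'I_n -> R) k : A \in unitmx ->
  \sum_l \sum_m A k l * invmx A l m * F m = F k.
Proof.
move=> A1; rewrite exchange_big /= -[RHS](sum_deltaC F); apply: eq_bigr => m _.
by rewrite -mulr_suml; have /matrixP/(_ k m) := mulmxV A1; rewrite !mxE => ->.
Qed.

End FiniteSums.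

(** Contraction of the upper index in the derivative of the shifted Christoffel symbols: the
    Kronecker deltas of [conformal_shift] select [b] and [c], and its metric term, by Leibniz,
    leaves the sums of [C] and [D]. *)
Lemma sum_shift_derivative (R : realType) n (F A B1 B2 C D : 'I_n -> R) b c r :
  (forall a, F a = A a + ((a == b)%:R * B1 a + (a == c)%:R * B2 a)
                   - (C a + r * D a)) ->
  \sum_a F a = \sum_a A a + (B1 b + B2 c) - \sum_a C a - r * \sum_a D a.
Proof.
move=> E; under eq_bigr do rewrite E.
by rewrite sumrB !big_split /= !sum_delta -mulr_sumr; ring.
Qed.

(** * Algebra of the conformal change of the Christoffel symbols *)

Section ShiftAlgebra.
Context {R : realType} {n : nat}.
Variables (G : 'M[R]_n) (u w : 'I_n -> R) (Gamma Gamma1 : 'I_n -> 'I_n -> 'I_n -> R).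
Hypothesis symG : forall a b, G a b = G b a.
Hypothesis lower_w : forall k, \sum_l G k l * w l = u k.
Hypothesis GammaC : forall k a b, Gamma k a b = Gamma k b a.
Hypothesis lower_Gamma : forall l a b,
  \sum_k G l k * Gamma k a b = Gamma1 l a b.

(* The change of the Christoffel symbols when [G] is replaced by [e^{2u} G],
   where [w] is the gradient of [u]. *)
Definition conformal_shift (k a b : 'I_n) : R :=
  (k == a)%:R * u b + (k == b)%:R * u a - G a b * w k.

Local Notation C := conformal_shift.
Local Notation q := (\sum_k u k * w k).

Lemma conformal_shiftC k a b : C k a b = C k b a.
Proof. by rewrite /C (symG a b) [X in X - _]addrC. Qed.

(** The right-hand side is what differentiating the factor [e^{2u}] contributes to the coordinate
    formula for the Christoffel symbols. *)
Lemma conformal_shiftE (ginv : 'M[R]_n) k a b :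
  (forall c, \sum_l ginv k l * G l c = (k == c)%:R) ->
  \sum_l ginv k l * u l = w k ->
  C k a b
  = \sum_l ginv k l * (G b l * u a + G a l * u b - G a b * u l).
Proof.
move=> invG wE; under eq_bigr do rewrite mulrBr mulrDr.
have E c (y : R) : \sum_l ginv k l * (G c l * y) = (k == c)%:R * y.
  by under eq_bigr do rewrite mulrA symG; rewrite -mulr_suml invG.
rewrite sumrB big_split /= !E /C [X in X - _]addrC; congr (_ - _).
by rewrite -wE mulr_sumr; apply: eq_bigr => l _; rewrite mulrCA.
Qed.

Lemma sum_shift c (X : 'I_n -> 'I_n -> R) :
  \sum_a \sum_m X a m * C m a c
  = \sum_a X a c * u a + (\sum_a X a a) * u c
    - \sum_m (\sum_a G c a * X a m) * w m.
Proof.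
under eq_bigr => a _.
  under eq_bigr => m _ do
    rewrite /C mulrBr mulrDr [X a m * ((m == a)%:R * _)]mulrCA
            [X a m * ((m == c)%:R * _)]mulrCA.
  rewrite sumrB big_split /= (sum_delta (fun m => X a m * u c)).
  rewrite (sum_delta (fun m => X a m * u a)).
  over.
rewrite sumrB big_split /= -mulr_suml [X in X - _]addrC; congr (_ - _).
rewrite exchange_big /=; apply: eq_bigr => m _; rewrite mulr_suml.
by apply: eq_bigr => a _; rewrite (symG a c); ring.
Qed.

(** The deltas give [n + 1] copies of [u m] and the metric term removes one. Geometrically, the
    volume density is multiplied by [e^{nu}]. *)
Lemma trace_shift m : \sum_a C a a m = n%:R * u m.
Proof.
rewrite /C sumrB big_split /= (sum_delta (fun a => u a)).
under eq_bigr do rewrite eqxx mul1r.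
rewrite sumr_const card_ord -[u m *+ n]mulr_natl -[RHS]addr0 -addrA.
congr (_ + _).
under eq_bigr do rewrite (symG _ m).
by rewrite lower_w subrr.
Qed.

Lemma shift_dot b c (v : 'I_n -> R) :
  \sum_a C a b c * v a = v b * u c + v c * u b - G b c * \sum_a v a * w a.
Proof.
rewrite /C; under eq_bigr do rewrite mulrBl mulrDl -!mulrA.
rewrite sumrB big_split /= (sum_delta (fun a => u c * v a)).
rewrite (sum_delta (fun a => u b * v a)) mulr_sumr.
congr (_ + _ - _); rewrite 1?mulrC//; apply: eq_bigr => a _.
by rewrite [v a * _]mulrC.
Qed.

Lemma shift_square b c :
  \sum_a \sum_m C a b m * C m a c = (n%:R + 2) * (u b * u c) - 2 * G b c * q.
Proof.
rewrite sum_shift shift_dot.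
have -> : \sum_a C a b a = n%:R * u b.
  by rewrite -trace_shift; apply: eq_bigr => a _; exact: conformal_shiftC.
have -> : \sum_m (\sum_a G c a * C a b m) * w m = G b c * q.
  have E m : \sum_a G c a * C a b m = G c b * u m + G c m * u b - G b m * u c.
    by under eq_bigr do rewrite mulrC; rewrite shift_dot lower_w.
  under eq_bigr do rewrite E mulrBl mulrDl.
  have E' a (y : R) : \sum_m G a m * y * w m = y * u a.
    by rewrite -lower_w mulr_sumr; apply: eq_bigr => m _; ring.
  rewrite sumrB big_split /= !E' (symG c b) mulr_sumr [u b * _]mulrC addrK.
  by apply: eq_bigr => m _; rewrite mulrA.
by ring.
Qed.

Lemma christoffel_shift b c :
  \sum_a \sum_m Gamma a b m * C m a c
  = \sum_k Gamma k b c * u k + (\sum_a Gamma a a b) * u c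
    - \sum_m Gamma1 c b m * w m.
Proof.
rewrite sum_shift; congr (_ + _ * _ - _).
  by apply: eq_bigr => a _.
by apply: eq_bigr => m _; rewrite lower_Gamma.
Qed.

Local Notation g m := (\sum_a Gamma a a m).
Local Notation H b c := (\sum_k Gamma k b c * u k).

Lemma shifted_trace_term b c :
  \sum_a \sum_m (Gamma a a m + C a a m) * (Gamma m b c + C m b c)
  = \sum_a \sum_m Gamma a a m * Gamma m b c
    + (g b * u c + g c * u b - G b c * \sum_m g m * w m)
    + n%:R * H b c + n%:R * (2 * u b * u c - G b c * q).
Proof.
rewrite exchange_big [in RHS]exchange_big /=.
under eq_bigr do rewrite -mulr_suml; under [in RHS]eq_bigr do rewrite -mulr_suml.
have E m : (\sum_a (Gamma a a m + C a a m)) * (Gamma m b c + C m b c) =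
    g m * Gamma m b c + C m b c * g m
    + n%:R * (Gamma m b c * u m) + n%:R * (C m b c * u m).
  by rewrite big_split /= trace_shift; ring.
under eq_bigr do rewrite E; rewrite !big_split /= -!mulr_sumr !shift_dot.
by ring.
Qed.

(** The two cross terms are exchanged by swapping [b] with [c] and the summation indices, so
    [christoffel_shift] handles both; the part quadratic in the shift is [shift_square]. *)
Lemma shifted_mixed_term b c :
  \sum_a \sum_m (Gamma a b m + C a b m) * (Gamma m a c + C m a c)
  = \sum_a \sum_m Gamma a b m * Gamma m a c
    + (H b c + g b * u c - \sum_m Gamma1 c b m * w m)
    + (H b c + g c * u b - \sum_m Gamma1 b c m * w m)
    + ((n%:R + 2) * (u b * u c) - 2 * G b c * q).
Proof.
have HC : H b c = H c b by apply: eq_bigr => k _; rewrite GammaC.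
rewrite {2}HC -shift_square -!christoffel_shift.
rewrite [X in _ = _ + X + _]exchange_big -!big_split; apply: eq_bigr => a _ /=.
rewrite -!big_split; apply: eq_bigr => m _ /=.
by rewrite [C a m b]conformal_shiftC (GammaC m c a); ring.
Qed.

End ShiftAlgebra.

(** * Symbols of the first kind, gradient, Hessian and divergence *)

Section Metric.
Context {R : realType} {n : nat}.
Variables (U : set 'rV[R]_n) (G : 'rV[R]_n -> 'M[R]_n).
Hypotheses (oU : open U) (sG : smooth_mx_on U G).
Hypotheses (symG : forall x, U x -> (G x)^T = G x).
Hypotheses (unitG : forall x, U x -> G x \in unitmx).

Local Notation Gamma := (christoffel G).

(* The symbols of the first kind, with the index [l] lowered. *)
Definition christoffel1 (x : 'rV[R]_n) (l a b : 'I_n) : R :=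
  2^-1 * (pd a (fun y => G y b l) x + pd b (fun y => G y a l) x
     - pd l (fun y => G y a b) x).

Lemma metricC x a b : U x -> G x a b = G x b a.
Proof. by move=> /symG/matrixP/(_ b a); rewrite mxE. Qed.

Lemma invmetricC x a b : U x -> invmx (G x) a b = invmx (G x) b a.
Proof.
by move=> Ux; have := trmx_inv (G x); rewrite symG// => /matrixP/(_ a b); rewrite mxE.
Qed.

Lemma pd_metricC x a b c : U x ->
  pd c (fun y => G y a b) x = pd c (fun y => G y b a) x.
Proof. by move=> Ux; apply: eq_pd_on oU Ux _ => y; exact: metricC. Qed.

Lemma christoffelE x k a b :
  Gamma x k a b = \sum_l invmx (G x) k l * christoffel1 x l a b.
Proof.
rewrite /christoffel mulr_sumr; apply: eq_bigr => l _.
by rewrite /christoffel1 mulrCA.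
Qed.

Lemma christoffel1C x l a b : U x -> christoffel1 x l a b = christoffel1 x l b a.
Proof.
move=> Ux; rewrite /christoffel1 (pd_metricC a b l Ux).
by rewrite [X in X - _]addrC.
Qed.

Lemma christoffelC x k a b : U x -> Gamma x k a b = Gamma x k b a.
Proof.
by move=> Ux; rewrite !christoffelE; apply: eq_bigr => l _; rewrite christoffel1C.
Qed.

Lemma lower_christoffel x l a b : U x ->
  \sum_k G x l k * Gamma x k a b = christoffel1 x l a b.
Proof.
move=> Ux; rewrite -[RHS](sum_mx_inv (christoffel1 x ^~ a ^~ b) _ (unitG Ux)).
apply: eq_bigr => k _; rewrite christoffelE mulr_sumr.
by apply: eq_bigr => m _; rewrite mulrA.
Qed.

Lemma metric_compatible x a b c : U x ->
  pd a (fun y => G y b c) x = christoffel1 x b a c + christoffel1 x c a b.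
Proof.
move=> Ux; by rewrite /christoffel1 (pd_metricC c b a Ux); field.
Qed.

Lemma metric_differentiable x a b : U x -> differentiable (fun y => G y a b) x.
Proof. exact: smooth_differentiable (sG a b). Qed.

Lemma smooth_christoffel k a b : smooth_on U (fun x => Gamma x k a b).
Proof.
apply: smoothM => //; first exact: smooth_cst.
apply: smooth_sum => // l; apply: smoothM => //.
  exact: smooth_invmx.
apply: smoothB => //; first apply: smoothD => //; exact: smooth_pd.
Qed.

Opaque christoffel.

Section Gradient.
Variable u : 'rV[R]_n -> R.
Hypothesis su : smooth_on U u.

Local Notation w x k := (grad G u x 0 k).

Lemma gradE x k : w x k = \sum_l pd l u x * invmx (G x) l k.
Proof. by rewrite mxE; apply: eq_bigr => l _; rewrite mxE. Qed.

Lemma lower_grad x k : U x -> \sum_l G x k l * w x l = pd k u x.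
Proof.
move=> Ux; rewrite -[RHS](sum_mx_inv (fun m => pd m u x) _ (unitG Ux)).
apply: eq_bigr => l _; rewrite gradE mulr_sumr; apply: eq_bigr => m _.
by rewrite (invmetricC m l Ux) -mulrA; congr (_ * _); rewrite mulrC.
Qed.

(** Writing [du] as the lowered gradient moves the index down on the Christoffel symbol. In this
    form the inverse metric enters only through the gradient, which suits both the change of
    coordinates and the ambient computation. *)
Lemma hess_christoffel1 x a b : U x ->
  hess G u x a b = pd a (pd b u) x - \sum_l christoffel1 x l a b * w x l.
Proof.
move=> Ux; rewrite mxE; congr (_ - _).
under [RHS]eq_bigr do rewrite -lower_christoffel// mulr_suml.
rewrite exchange_big; apply: eq_bigr => k _ /=.
rewrite -lower_grad// mulr_sumr; apply: eq_bigr => l _.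
by rewrite (metricC k l Ux); ring.
Qed.

Lemma smooth_grad : smooth_mx_on U (grad G u).
Proof.
apply: smooth_mxM => //; last exact: smooth_invmx.
by move=> i k; under eq_fun do rewrite mxE; exact: smooth_pd.
Qed.

Lemma smooth_hess : smooth_mx_on U (hess G u).
Proof.
move=> a b; under eq_fun do rewrite mxE; apply: smoothB => //.
  exact/smooth_pd/smooth_pd.
apply: smooth_sum => // k; apply: smoothM => //; last exact: smooth_pd.
exact: smooth_christoffel.
Qed.

Lemma hess_sym x : U x -> (hess G u x)^T = hess G u x.
Proof.
move=> Ux; apply/matrixP => a b; rewrite !mxE (pdC b a oU Ux su).
by congr (_ - _); apply: eq_bigr => k _; rewrite christoffelC.
Qed.

Lemma sqnorm_gradE x : U x -> sqnorm G x (grad G u x) = \sum_k pd k u x * w x k.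
Proof.
move=> Ux; rewrite /sqnorm mxE; under eq_bigr do rewrite mxE [X in _ * X]mxE.
rewrite -[LHS]/(\sum_j _); apply: eq_bigr => k _; congr (_ * _).
rewrite -lower_grad//; apply: eq_bigr => l _.
by rewrite mulrC (metricC l k Ux).
Qed.

Lemma smooth_sqnorm_grad : smooth_on U (fun x => sqnorm G x (grad G u x)).
Proof.
apply: (@smooth_mxM _ _ U _ _ _ _ _ oU) => //.
  by apply: smooth_mxM => //; exact: smooth_grad.
exact/smooth_tr/smooth_grad.
Qed.

Definition laplacian (x : 'rV[R]_n) : R := trace_wrt G x (hess G u x).

Lemma trace_wrtE x S : trace_wrt G x S = \sum_a \sum_b invmx (G x) a b * S b a.
Proof. by rewrite /trace_wrt /mxtrace; apply: eq_bigr => a _; rewrite mxE. Qed.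

(** The divergence of the gradient is the trace of the Hessian. Differentiating [du = G w] and
    tracing avoids differentiating the inverse metric; metric compatibility then turns the
    derivatives of [G] into Christoffel symbols. *)
Lemma divergence_grad x : U x ->
  \sum_a pd a (fun y => w y a) x
  = laplacian x - \sum_c (\sum_a Gamma x a a c) * w x c.
Proof.
move=> Ux.
have dw c : differentiable (fun y => w y c) x.
  exact: smooth_differentiable (smooth_grad 0 c) Ux.
have E a b : pd b (pd a u) x =
    \sum_c pd b (fun y => G y a c) x * w x c
    + \sum_c G x a c * pd b (fun y => w y c) x.
  rewrite -big_split /= -(eq_pd_on (f := fun y => \sum_c G y a c * w y c) b oU Ux);
    last by move=> y; exact: lower_grad.
  rewrite pd_sum => [|c]; last exact/differentiableMf/dw/metric_differentiable.
  by apply: eq_bigr => c _; rewrite pdM//; exact: metric_differentiable.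
have -> : laplacian x =
    \sum_a \sum_b invmx (G x) a b * (\sum_c christoffel1 x a b c * w x c)
    + \sum_a \sum_b invmx (G x) a b *
        (\sum_c G x a c * pd b (fun y => w y c) x).
  rewrite /laplacian trace_wrtE -big_split; apply: eq_bigr => a _ /=.
  rewrite -big_split; apply: eq_bigr => b _ /=; rewrite -mulrDr.
  congr (_ * _); rewrite mxE E addrAC; congr (_ + _).
  have -> : \sum_k Gamma x k b a * pd k u x = \sum_c christoffel1 x c b a * w x c.
    under [RHS]eq_bigr do rewrite -lower_christoffel// mulr_suml.
    rewrite exchange_big /=; apply: eq_bigr => k _.
    rewrite -lower_grad// mulr_sumr; apply: eq_bigr => l _.
    by rewrite (metricC k l Ux); ring.
  rewrite -sumrB; apply: eq_bigr => c _.
  by rewrite metric_compatible//; ring.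
(* The inverse metric raises the first index again, so this is the trace of the Christoffel symbols
   against [w]. *)
have -> : \sum_a \sum_b invmx (G x) a b * (\sum_c christoffel1 x a b c * w x c)
    = \sum_c (\sum_a Gamma x a a c) * w x c.
  under [RHS]eq_bigr do rewrite mulr_suml; rewrite [RHS]exchange_big /=.
  rewrite exchange_big /=; apply: eq_bigr => b _.
  under eq_bigr do rewrite mulr_sumr; rewrite exchange_big; apply: eq_bigr => c _.
  rewrite christoffelE mulr_suml; apply: eq_bigr => a _.
  by rewrite mulrA (invmetricC a b Ux).
rewrite addrAC subrr add0r exchange_big; apply: eq_bigr => b _ /=.
rewrite -[LHS](sum_invmx (fun c => pd b (fun y => w y c) x) b (unitG Ux)).
apply: eq_bigr => a _; rewrite mulr_sumr; apply: eq_bigr => c _.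
by rewrite mulrA (invmetricC a b Ux).
Qed.

End Gradient.
End Metric.

(** * Conformal change of the metric *)

Lemma ricciE (R : realType) n (G : 'rV[R]_n -> 'M[R]_n) x b c :
  ricci G x b c = \sum_a pd a (fun y => christoffel G y a b c) x
    - \sum_a pd b (fun y => christoffel G y a a c) x
    + (\sum_a \sum_m christoffel G x a a m * christoffel G x m b c
       - \sum_a \sum_m christoffel G x a b m * christoffel G x m a c).
Proof.
rewrite mxE -!sumrB -big_split; apply: eq_bigr => a _ /=.
by rewrite -sumrB.
Qed.

Section ConformalChange.
Context {R : realType} {n : nat}.
Variables (U : set 'rV[R]_n) (G : 'rV[R]_n -> 'M[R]_n) (u : 'rV[R]_n -> R).
Hypotheses (oU : open U) (sG : smooth_mx_on U G).
Hypotheses (symG : forall x, U x -> (G x)^T = G x).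
Hypotheses (unitG : forall x, U x -> G x \in unitmx).
Hypothesis su : smooth_on U u.

Let Gu : 'rV[R]_n -> 'M[R]_n := fun x => expR (2 * u x) *: G x.

Local Notation Gamma := (christoffel G).
Local Notation w x := (grad G u x 0).
Local Notation du x := (fun k => pd k u x).
Local Notation C x := (conformal_shift (G x) (du x) (w x)).

Lemma expR_neq0 (r : R) : expR r != 0. Proof. by rewrite gt_eqF ?expR_gt0. Qed.

Lemma conformal_unit x : U x -> Gu x \in unitmx.
Proof. by move=> Ux; rewrite unitmxZ ?unitfE ?expR_neq0 ?unitG. Qed.

Lemma invmx_conformal x : U x -> invmx (Gu x) = expR (- (2 * u x)) *: invmx (G x).
Proof. by move=> Ux; rewrite expRN invmxZ// conformal_unit. Qed.

Lemma smooth_conformal : smooth_mx_on U Gu.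
Proof.
apply: smooth_mxZ => //; apply: smooth_expR => //.
by apply: smoothM => //; exact: smooth_cst.
Qed.

Lemma pd_conformal_metric x a b c : U x ->
  pd c (fun y => Gu y a b) x
  = expR (2 * u x) * (2 * pd c u x * G x a b + pd c (fun y => G y a b) x).
Proof.
move=> Ux; under eq_fun do rewrite mxE.
have dux := smooth_differentiable su Ux.
have d2u : differentiable (fun y => 2 * u y) x by exact: differentiableMf.
have dG := metric_differentiable sG a b Ux.
have de := differentiable_expR d2u.
by rewrite pdM// pd_expR// pdZ//; ring.
Qed.

(** The factor [e^{-2u}] of the inverse cancels the [e^{2u}] in the derivatives of the metric; what
    the derivative of the factor leaves is read off from [conformal_shiftE]. *)
Lemma christoffel_conformal x k a b : U x ->
  christoffel Gu x k a b = Gamma x k a b + C x k a b.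
Proof.
move=> Ux; rewrite !christoffelE invmx_conformal//.
rewrite (@conformal_shiftE _ _ _ _ _ _ (invmx (G x)))//; first last.
- by rewrite gradE; apply: eq_bigr => l _; rewrite (invmetricC symG l k Ux) mulrC.
- by move=> c; have /matrixP/(_ k c) := mulVmx (unitG Ux); rewrite !mxE.
- by move=> c d; exact: metricC Ux.
rewrite -big_split; apply: eq_bigr => l _ /=.
rewrite /christoffel1 !pd_conformal_metric// mxE expRN.
have := expR_neq0 (2 * u x); move: (expR _) (invmx _ k l) => e i e0.
move: (pd a (fun y => G y b l) x) (pd b (fun y => G y a l) x) => p1 p2.
move: (pd l (fun y => G y a b) x) (pd a u x) (pd b u x) (pd l u x) => p3 q1 q2 q3.
by field.
Qed.

Lemma hess_conformal v x : U x ->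
  hess Gu v x = hess G v x - ((dfun u x)^T *m dfun v x + (dfun v x)^T *m dfun u x)
    + (\sum_k pd k v x * w x k) *: G x.
Proof.
move=> Ux; apply/matrixP => a b; rewrite !mxE !big_ord1 !mxE.
under eq_bigr do rewrite christoffel_conformal// mulrDl.
rewrite big_split /= (shift_dot _ _ _ _ _ (fun k => pd k v x)).
move: (\sum_k _) (\sum_k _) (pd a (pd b v) x) (pd a v x) (pd b v x) => r s t a' b'.
by move: (G x a b) (pd a u x) (pd b u x) => G' c d; ring.
Qed.

(** The shift is inserted into the four sums of [ricciE]. The terms that are not tensors, namely
    traces of the Christoffel symbols and derivatives of [G], cancel between the divergence part and
    the quadratic part. *)
Lemma ricci_conformal x : U x ->
  ricci Gu x = ricci G x - (n%:R - 2) *: (hess G u x - (dfun u x)^T *m dfun u x)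
    - (laplacian G u x + (n%:R - 2) * sqnorm G x (grad G u x)) *: G x.
Proof.
move=> Ux; apply/matrixP => b c.
have ChrE y k i j := christoffel_conformal k i j (x := y).
have dGam k i j := smooth_differentiable (smooth_christoffel oU sG unitG k i j) Ux.
have dux k := smooth_differentiable (smooth_pd k su) Ux.
have dw k := smooth_differentiable (smooth_grad oU sG unitG su 0 k) Ux.
have dG i j := metric_differentiable sG i j Ux.
have symx i j : G x i j = G x j i := metricC symG i j Ux.
have lowx k : \sum_l G x k l * w x l = pd k u x := lower_grad symG unitG u k Ux.
have GamC k i j : Gamma x k i j = Gamma x k j i := christoffelC oU symG k i j Ux.
have lowG l i j : \sum_k G x l k * Gamma x k i j = christoffel1 G x l i j
  := lower_christoffel unitG l i j Ux.
pose g m := \sum_a Gamma x a a m.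
have S1 : \sum_a pd a (fun y => christoffel Gu y a b c) x =
    \sum_a pd a (fun y => Gamma y a b c) x + 2 * pd b (pd c u) x
    - \sum_a pd a (fun y => G y b c) x * w x a
    - G x b c * (laplacian G u x - \sum_a g a * w x a).
  have E a : pd a (fun y => christoffel Gu y a b c) x =
      pd a (fun y => Gamma y a b c) x + ((a == b)%:R * pd a (pd c u) x
      + (a == c)%:R * pd a (pd b u) x)
      - (pd a (fun y => G y b c) x * w x a + G x b c * pd a (fun y => w y a) x).
    rewrite (eq_pd_on a oU Ux (fun y Uy => ChrE y a b c Uy)).
    rewrite /conformal_shift pdD//; last first.
      apply: differentiableDf; last exact/differentiableNf/differentiableMf.
      by apply: differentiableDf; apply: differentiableMf.
    rewrite pdB//; [|by apply: differentiableDf; apply: differentiableMf|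
                     exact: differentiableMf].
    rewrite pdD//; [|exact: differentiableMf|exact: differentiableMf].
    by rewrite (pdZ a _ (dux c)) (pdZ a _ (dux b)) (pdM a (dG b c) (dw a)) addrA.
  etransitivity; first exact: sum_shift_derivative E.
  have := divergence_grad oU sG symG unitG su Ux; rewrite -/g => ->.
  have := pdC c b oU Ux su => ->.
  move: (laplacian _ _ _) (\sum_c _ * _) (\sum_a _) (\sum_a _) (pd b _ x) => l s t r p.
  by ring.
(* The trace of the shift is [n du]. It is computed on all of [U], since it is about to be
   differentiated. *)
have S2 : \sum_a pd b (fun y => christoffel Gu y a a c) x =
    \sum_a pd b (fun y => Gamma y a a c) x + n%:R * pd b (pd c u) x.
  have dGu a : differentiable (fun y => christoffel Gu y a a c) x.
    have sGa := smooth_christoffel oU smooth_conformal conformal_unit a a c.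
    exact: smooth_differentiable sGa Ux.
  have E y : U y -> \sum_a christoffel Gu y a a c =
      \sum_a Gamma y a a c + n%:R * pd c u y.
    move=> Uy; have symy i j : G y i j = G y j i := metricC symG i j Uy.
    have lowy k : \sum_l G y k l * w y l = pd k u y := lower_grad symG unitG u k Uy.
    rewrite -(trace_shift symy lowy c) -big_split; apply: eq_bigr => a _.
    exact: ChrE.
  etransitivity; first by symmetry; exact: pd_sum dGu.
  etransitivity; first exact: eq_pd_on oU Ux E.
  have dS : differentiable (fun y => \sum_a Gamma y a a c) x.
    exact: differentiable_sumf.
  etransitivity; first exact: pdD dS (differentiableMf (differentiable_cstf _ _) (dux c)).
  congr (_ + _); last exact: pdZ (dux c).
  exact: (pd_sum _ _ _ (fun a => dGam a a c)).
have S3 : \sum_a \sum_m christoffel Gu x a a m * christoffel Gu x m b c =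
    \sum_a \sum_m (Gamma x a a m + C x a a m) * (Gamma x m b c + C x m b c).
  apply: eq_bigr => a _; apply: eq_bigr => m _.
  by rewrite (ChrE x a a m Ux) (ChrE x m b c Ux).
have {}S3 := etrans S3 (shifted_trace_term (Gamma x) symx lowx b c).
have S4 : \sum_a \sum_m christoffel Gu x a b m * christoffel Gu x m a c =
    \sum_a \sum_m (Gamma x a b m + C x a b m) * (Gamma x m a c + C x m a c).
  apply: eq_bigr => a _; apply: eq_bigr => m _.
  by rewrite (ChrE x a b m Ux) (ChrE x m a c Ux).
have {}S4 := etrans S4 (shifted_mixed_term symx lowx GamC lowG b c).
(* Metric compatibility expresses the derivative of [G] along [w], coming from [S1], by the same
   symbols of the first kind as occur in [S4]. *)
have S5 : \sum_a pd a (fun y => G y b c) x * w x a =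
    \sum_m christoffel1 G x c b m * w x m + \sum_m christoffel1 G x b c m * w x m.
  rewrite -big_split; apply: eq_bigr => a _ /=; rewrite -mulrDl.
  congr (_ * _); rewrite (metric_compatible oU symG a b c Ux) addrC.
  by congr (_ + _); exact: (christoffel1C oU symG).
have RU := etrans (ricciE Gu x b c)
  (congr2 +%R (congr2 (fun p q => p - q) S1 S2) (congr2 (fun p q => p - q) S3 S4)).
(* With every contraction replaced by a scalar, what remains is a polynomial identity: [gm], [gb],
   [gc], [K1] and [K2] drop out. *)
have combine N A B P Q l Gbc ubc ub uc d gm gb gc H q K1 K2 ru r0 :
    ru = A + 2 * ubc - d - Gbc * (l - gm) - (B + N * ubc)
      + (P + (gb * uc + gc * ub - Gbc * gm) + N * H + N * (2 * ub * uc - Gbc * q)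
         - (Q + (H + gb * uc - K1) + (H + gc * ub - K2)
            + ((N + 2) * (ub * uc) - 2 * Gbc * q))) ->
    r0 = A - B + (P - Q) -> d = K1 + K2 ->
    ru = r0 - (N - 2) * (ubc - H - ub * uc) - (l + (N - 2) * q) * Gbc :> R.
  by move=> -> -> ->; ring.
rewrite (combine _ _ _ _ _ _ _ _ _ _ _ _ _ _ _ _ _ _ _ _ RU (ricciE G x b c) S5).
by rewrite (sqnorm_gradE symG unitG u Ux) !mxE big_ord1 !mxE.
Qed.

Lemma trace_conformal x S : U x ->
  trace_wrt Gu x S = expR (- (2 * u x)) * trace_wrt G x S.
Proof. by move=> Ux; rewrite /trace_wrt invmx_conformal// -scalemxAl mxtraceZ. Qed.

Lemma trace_metric x : U x -> trace_wrt G x (G x) = n%:R.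
Proof. by move=> Ux; rewrite /trace_wrt mulVmx ?unitG// mxtrace1. Qed.

Lemma trace_wrtD x S S' : trace_wrt G x (S + S') = trace_wrt G x S + trace_wrt G x S'.
Proof. by rewrite /trace_wrt mulmxDr mxtraceD. Qed.

Lemma trace_wrtZ x r S : trace_wrt G x (r *: S) = r * trace_wrt G x S.
Proof. by rewrite /trace_wrt -scalemxAr mxtraceZ. Qed.

Lemma trace_wrtN x S : trace_wrt G x (- S) = - trace_wrt G x S.
Proof. by rewrite /trace_wrt mulmxN raddfN. Qed.

Lemma trace_du_du x : U x ->
  trace_wrt G x ((dfun u x)^T *m dfun u x) = sqnorm G x (grad G u x).
Proof.
move=> Ux; rewrite (sqnorm_gradE symG unitG)// trace_wrtE exchange_big /=.
apply: eq_bigr => b _; rewrite gradE mulr_sumr; apply: eq_bigr => a _.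
by rewrite !mxE big_ord1 !mxE mulrC -mulrA; congr (_ * _).
Qed.

(** As [G] has trace [n], the Laplacian gets the coefficient [-(n-2) - n] and the squared gradient
    [(n-2) - n(n-2)]. *)
Lemma scalar_curvature_conformal x : U x ->
  scalar_curvature Gu x = expR (- (2 * u x)) *
    (scalar_curvature G x - 2 * (n%:R - 1) * laplacian G u x
     - (n%:R - 1) * (n%:R - 2) * sqnorm G x (grad G u x)).
Proof.
move=> Ux; rewrite /scalar_curvature trace_conformal// ricci_conformal//.
rewrite !(trace_wrtD, trace_wrtN, trace_wrtZ) trace_metric// trace_du_du//.
rewrite -/(laplacian G u x); congr (_ * _).
by move: (laplacian _ _ _) (trace_wrt _ _ _) (sqnorm _ _ _) => l t s; ring.
Qed.

End ConformalChange.

(** * Change of coordinates *)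

Section TensorialityAlgebra.
Context {R : realType} {n : nat}.
(* [J] and [F] are the first and second derivatives of the change of coordinates,
   [dG] and [dH] those of the metric [G] and of its expression [H] in the new
   coordinates; [w] is a gradient for [G] and [v] the corresponding
   differential in the new coordinates. *)
Variables (J H : 'M[R]_n) (F dH dG : 'I_n -> 'I_n -> 'I_n -> R) (w v : 'I_n -> R).
Let W q := \sum_l w l * J l q.
Hypothesis symH : forall p q, H p q = H q p.
Hypothesis FC : forall a b p, F a b p = F b a p.
Hypothesis lowerW : forall p, \sum_q H p q * W q = v p.
Hypothesis dGE : forall c a b, dG c a b = \sum_p \sum_q
  (F c a p * H p q * J b q + J a p * H p q * F c b q
   + J a p * (\sum_r J c r * dH r p q) * J b q).

(** [P] collects the second derivatives of the change of coordinates; [t X Y Z] is the derivative of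
    the new metric in direction [X], evaluated on [Y] and [Z]. *)
Let P c a b := \sum_p \sum_q F c a p * H p q * J b q.
Let t (X Y Z : 'I_n -> R) := \sum_p \sum_q \sum_r X r * Y p * Z q * dH r p q.

Let dGPt c a b : dG c a b = P c a b + P c b a + t (J c) (J a) (J b).
Proof.
rewrite dGE /P [X in _ + X + _]exchange_big -!big_split; apply: eq_bigr => p _ /=.
rewrite -!big_split; apply: eq_bigr => q _ /=; rewrite (symH q p).
rewrite [X in _ = _ + X](_ : _ = J a p * (\sum_r J c r * dH r p q) * J b q).
  by ring.
by rewrite mulr_sumr mulr_suml; apply: eq_bigr => r _; ring.
Qed.

Let PC c a b : P c a b = P a c b.
Proof. by apply: eq_bigr => p _; apply: eq_bigr => q _; rewrite FC. Qed.

Let sumP a b : \sum_l P a b l * w l = \sum_p F a b p * v p.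
Proof.
rewrite /P; under eq_bigr do rewrite mulr_suml.
rewrite exchange_big; apply: eq_bigr => p _ /=; rewrite -lowerW mulr_sumr.
under eq_bigr do rewrite mulr_suml.
rewrite exchange_big; apply: eq_bigr => q _ /=; rewrite /W !mulr_sumr.
by apply: eq_bigr => l _; ring.
Qed.

Let sumt1 Y Z : \sum_l t (J l) Y Z * w l = t W Y Z.
Proof.
rewrite /t; under eq_bigr do rewrite mulr_suml.
rewrite exchange_big; apply: eq_bigr => p _ /=; under eq_bigr do rewrite mulr_suml.
rewrite exchange_big; apply: eq_bigr => q _ /=; under eq_bigr do rewrite mulr_suml.
rewrite exchange_big; apply: eq_bigr => r _ /=; rewrite /W !mulr_suml.
by apply: eq_bigr => l _; ring.
Qed.

Let sumt3 X Y : \sum_l t X Y (J l) * w l = t X Y W.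
Proof.
rewrite /t; under eq_bigr do rewrite mulr_suml.
rewrite exchange_big; apply: eq_bigr => p _ /=; under eq_bigr do rewrite mulr_suml.
rewrite exchange_big; apply: eq_bigr => q _ /=; under eq_bigr do rewrite mulr_suml.
rewrite exchange_big; apply: eq_bigr => r _ /=; rewrite /W !mulr_sumr !mulr_suml.
by apply: eq_bigr => l _; ring.
Qed.

(** Transformation law of the Christoffel symbols, paired with a gradient. Of the six terms [P],
    four cancel and the other two agree by the symmetry of [F]; they form the inhomogeneous term
    [F v]. *)
Lemma christoffel_tensoriality a b :
  \sum_l 2^-1 * (dG a b l + dG b a l - dG l a b) * w l
  = \sum_p F a b p * v p
    + \sum_p \sum_q J a p * J b q *
        \sum_r 2^-1 * (dH p q r + dH q p r - dH r p q) * W r.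
Proof.
have -> : \sum_p \sum_q J a p * J b q *
      (\sum_r 2^-1 * (dH p q r + dH q p r - dH r p q) * W r) =
    2^-1 * (t (J a) (J b) W + t (J b) (J a) W - t W (J a) (J b)).
  have -> : t (J a) (J b) W = \sum_p \sum_q \sum_r J a p * J b q * dH p q r * W r.
    rewrite /t; under eq_bigr do rewrite exchange_big; rewrite exchange_big /=.
    apply: eq_bigr => p _; apply: eq_bigr => q _; apply: eq_bigr => r _.
    by ring.
  have -> : t (J b) (J a) W = \sum_p \sum_q \sum_r J a p * J b q * dH q p r * W r.
    rewrite /t; apply: eq_bigr => p _; rewrite exchange_big /=.
    by apply: eq_bigr => q _; apply: eq_bigr => r _; ring.
  rewrite /t -big_split -sumrB mulr_sumr; apply: eq_bigr => p _ /=.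
  rewrite -big_split -sumrB mulr_sumr; apply: eq_bigr => q _ /=.
  rewrite -big_split -sumrB !mulr_sumr; apply: eq_bigr => r _ /=.
  by ring.
rewrite -sumP -!sumt3 -sumt1 -big_split -sumrB mulr_sumr -big_split.
apply: eq_bigr => l _ /=; rewrite !dGPt (PC l a b) (PC l b a) (PC b a l).
by field.
Qed.

End TensorialityAlgebra.

Lemma sub_times_differentiable (R : realType) n k (U W : set 'rV[R]_n) f :
  W `<=` U -> times_differentiable k U f -> times_differentiable k W f.
Proof.
move=> WU; elim: k f => // k IH f [df dpf]; split=> [x /WU|a]; first exact: df.
by apply: IH; exact: dpf.
Qed.

Lemma sub_smooth_on (R : realType) n (U W : set 'rV[R]_n) f :
  W `<=` U -> smooth_on U f -> smooth_on W f.
Proof. by move=> WU sf k; exact: sub_times_differentiable (sf k). Qed.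

Lemma smooth_mx_differentiable (R : realType) n m (U : set 'rV[R]_n)
    (phi : 'rV[R]_n -> 'rV[R]_m) x :
  smooth_mx_on U phi -> U x -> differentiable phi x.
Proof.
move=> sp Ux; apply: differentiable_rV => b.
exact: smooth_differentiable (sp 0 b) Ux.
Qed.

Section CoordinateChange.
Context {R : realType} {n : nat}.
Variables (W V : set 'rV[R]_n) (phi : 'rV[R]_n -> 'rV[R]_n).
Variables (G H : 'rV[R]_n -> 'M[R]_n) (u v : 'rV[R]_n -> R).
Hypotheses (oW : open W) (phiWV : forall x, W x -> V (phi x)).
Hypothesis sphi : smooth_mx_on W phi.
Hypothesis sH : smooth_mx_on V H.
Hypothesis symG : forall x, W x -> (G x)^T = G x.
Hypothesis symH : forall x, V x -> (H x)^T = H x.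
Hypothesis unitG : forall x, W x -> G x \in unitmx.
Hypothesis unitH : forall x, V x -> H x \in unitmx.
Hypothesis sv : smooth_on V v.
Hypothesis GE : forall x, W x -> G x = 'J phi x *m H (phi x) *m ('J phi x)^T.
Hypothesis uE : forall x, W x -> u x = v (phi x).

Let dphi x (Wx : W x) : differentiable phi x := smooth_mx_differentiable sphi Wx.

Lemma smooth_jacobian : smooth_mx_on W (jacobian phi).
Proof.
move=> a p; apply: (eq_smooth_on oW _ (smooth_pd a (sphi 0 p))) => y Wy.
by rewrite jacobianE//; exact: dphi.
Qed.

(** Read off from [G = J H J^T] with [G] invertible, so the inverse change of coordinates does not
    enter. *)
Lemma jacobian_unit x : W x -> 'J phi x \in unitmx.
Proof. by move=> Wx; have := unitG Wx; rewrite GE// -mulmxA unitmx_mul => /andP[]. Qed.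

Lemma pd_comp_on (f : 'rV[R]_n -> R) x a : smooth_on V f -> W x ->
  pd a (fun y => f (phi y)) x = \sum_p 'J phi x a p * pd p f (phi x).
Proof.
move=> sf Wx; apply: pd_comp; first exact: dphi.
exact: smooth_differentiable sf (phiWV Wx).
Qed.

Lemma differentiable_comp_on (f : 'rV[R]_n -> R) x : smooth_on V f -> W x ->
  differentiable (fun y => f (phi y)) x.
Proof.
move=> sf Wx; apply: differentiable_compf; first exact: dphi.
exact: smooth_differentiable sf (phiWV Wx).
Qed.

Lemma pd_coordinate_change x a : W x ->
  pd a u x = \sum_p 'J phi x a p * pd p v (phi x).
Proof. by move=> Wx; rewrite (eq_pd_on a oW Wx uE); exact: pd_comp_on. Qed.

Lemma dfun_coordinate_change x : W x ->
  dfun u x = dfun v (phi x) *m ('J phi x)^T.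
Proof.
move=> Wx; apply/rowP => a; rewrite !mxE pd_coordinate_change//.
by apply: eq_bigr => p _; rewrite !mxE mulrC.
Qed.

Lemma grad_coordinate_change x : W x ->
  grad H v (phi x) = grad G u x *m 'J phi x.
Proof.
move=> Wx; have J1 := jacobian_unit Wx.
have JT1 : ('J phi x)^T \in unitmx by rewrite unitmx_tr.
have E : grad G u x *m G x = dfun u x by rewrite /grad mulmxKV ?unitG.
move: E; rewrite (dfun_coordinate_change Wx) (GE Wx) !mulmxA.
move=> /(can_inj (mulmxK JT1)) E.
by rewrite /grad -E mulmxK// unitH//; exact: phiWV.
Qed.

Lemma sqnorm_coordinate_change x : W x ->
  sqnorm G x (grad G u x) = sqnorm H (phi x) (grad H v (phi x)).
Proof.
by move=> Wx; rewrite /sqnorm grad_coordinate_change// (GE Wx) (trmx_mul (grad G u x)) !mulmxA.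
Qed.

Let FE a b p x := pd a (fun y => 'J phi y b p) x.

Let FC a b p x : W x -> FE a b p x = FE b a p x.
Proof.
move=> Wx; rewrite /FE.
have E c d : pd c (fun y => 'J phi y d p) x = pd c (pd d (fun z => phi z 0 p)) x.
  by apply: (eq_pd_on c oW Wx) => y Wy; apply: jacobianE; exact: dphi.
by rewrite !E; exact: pdC oW Wx (sphi 0 p).
Qed.

Let pd2u x a b : W x -> pd a (pd b u) x =
  \sum_p FE a b p x * pd p v (phi x)
  + \sum_p \sum_q 'J phi x a p * 'J phi x b q * pd p (pd q v) (phi x).
Proof.
move=> Wx; rewrite (eq_pd_on a oW Wx (fun y => pd_coordinate_change b (x := y))).
have dJ p : differentiable (fun y => 'J phi y b p) x.
  exact: smooth_differentiable (smooth_jacobian b p) Wx.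
have dv p : differentiable (fun y => pd p v (phi y)) x.
  by apply: differentiable_comp_on => //; exact: smooth_pd.
rewrite pd_sum => [|p]; last exact: differentiableMf.
rewrite [X in _ = _ + X]exchange_big -big_split; apply: eq_bigr => q _ /=.
rewrite (pdM a (dJ q) (dv q)) (pd_comp_on a (smooth_pd q sv) Wx).
by congr (_ + _); rewrite mulr_sumr; apply: eq_bigr => p _; ring.
Qed.

Let pdG x c a b : W x -> pd c (fun y => G y a b) x = \sum_p \sum_q
  (FE c a p x * H (phi x) p q * 'J phi x b q
   + 'J phi x a p * H (phi x) p q * FE c b q x
   + 'J phi x a p * (\sum_r 'J phi x c r * pd r (fun z => H z p q) (phi x))
     * 'J phi x b q).
Proof.
move=> Wx.
have E y : W y -> G y a b =
    \sum_p \sum_q 'J phi y a p * H (phi y) p q * 'J phi y b q.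
  move=> Wy; rewrite (GE Wy) !mxE exchange_big; apply: eq_bigr => q _.
  by rewrite !mxE mulr_suml.
rewrite (eq_pd_on c oW Wx E).
have dJ d p : differentiable (fun y => 'J phi y d p) x.
  exact: smooth_differentiable (smooth_jacobian d p) Wx.
have dH p q := differentiable_comp_on (sH p q) Wx.
have dJH p q := differentiableMf (dJ a p) (dH p q).
have dJHJ p q := differentiableMf (dJH p q) (dJ b q).
rewrite pd_sum => [|p]; last exact: differentiable_sumf.
apply: eq_bigr => p _; rewrite pd_sum//; apply: eq_bigr => q _.
rewrite (pdM c (dJH p q) (dJ b q)) (pdM c (dJ a p) (dH p q)).
by rewrite (pd_comp_on c (sH p q) Wx) /FE; ring.
Qed.

(** The second derivatives of [phi], paired with [dv], occur in [pd a (pd b u)] by the chain rule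
    and in the Christoffel term by [christoffel_tensoriality]; they cancel. *)
Lemma hess_coordinate_change x : W x ->
  hess G u x = 'J phi x *m hess H v (phi x) *m ('J phi x)^T.
Proof.
move=> Wx; have Vx := phiWV Wx; apply/matrixP => a b.
rewrite (hess_christoffel1 symG unitG _ _ _ Wx) pd2u//.
have WE q : grad H v (phi x) 0 q = \sum_l grad G u x 0 l * 'J phi x l q.
  by rewrite grad_coordinate_change// mxE.
have T : \sum_l christoffel1 G x l a b * grad G u x 0 l =
    \sum_p FE a b p x * pd p v (phi x) + \sum_p \sum_q
      'J phi x a p * 'J phi x b q *
      \sum_r christoffel1 H (phi x) r p q * grad H v (phi x) 0 r.
  have symHx p q : H (phi x) p q = H (phi x) q p := metricC symH p q Vx.
  have FCx c d p : FE c d p x = FE d c p x := FC c d p Wx.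
  have lowx p : \sum_q H (phi x) p q * (\sum_l grad G u x 0 l * 'J phi x l q)
      = pd p v (phi x).
    rewrite -(lower_grad symH unitH v p Vx).
    by apply: eq_bigr => q _; rewrite WE.
  have := christoffel_tensoriality (dH := fun r p q => pd r (fun z => H z p q) (phi x))
    symHx FCx lowx (fun c a b => pdG c a b Wx) a b.
  move=> /= E; apply: (etrans E); congr (_ + _).
  apply: eq_bigr => p _; apply: eq_bigr => q _; congr (_ * _).
  by apply: eq_bigr => r _; rewrite -WE.
rewrite T [RHS]mxE opprD addrACA subrr add0r.
rewrite exchange_big /= [X in _ - X]exchange_big -sumrB; apply: eq_bigr => q _ /=.
rewrite [X in _ = X * _]mxE [X in _ = _ * X]mxE mulr_suml -sumrB.
apply: eq_bigr => p _ /=.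
by rewrite (hess_christoffel1 symH unitH _ _ _ Vx); ring.
Qed.

End CoordinateChange.

(** * The ambient metric *)

Opaque christoffel.

Section CovariantDerivative.
Context {R : realType} {n m : nat}.
Variables (Gt : 'rV[R]_n -> 'M[R]_n) (F v : 'rV[R]_m -> 'rV[R]_n) (x : 'rV[R]_m).

Definition cov_matrix : 'M[R]_(m, n) :=
  'J v x + \matrix_(a, k) \sum_b \sum_c
    christoffel Gt (F x) k b c * 'J F x a b * v x 0 c.

Lemma cov_derivE w : cov_deriv Gt F v x w = w *m cov_matrix.
Proof.
rewrite /cov_deriv mulmxDr; congr (_ + _); apply/rowP => k; rewrite !mxE.
under [RHS]eq_bigr do rewrite mxE mulr_sumr.
rewrite [RHS]exchange_big; apply: eq_bigr => b _ /=.
under [RHS]eq_bigr do rewrite mulr_sumr.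
rewrite [RHS]exchange_big; apply: eq_bigr => c _ /=.
rewrite mxE mulr_sumr mulr_suml; apply: eq_bigr => a _.
by ring.
Qed.

Hypothesis symGt : (Gt (F x))^T = Gt (F x).
Hypothesis unitGt : Gt (F x) \in unitmx.

Definition derivative_form (A B C : 'I_n -> R) : R :=
  \sum_a \sum_b \sum_c A a * B b * C c * pd a (fun y => Gt y b c) (F x).

Local Notation V a := ('J F x a).

(** A Koszul formula: pairing with tangent vectors lowers the Christoffel symbols of [Gt], so that
    three directional derivatives of the metric are all that is left of them. *)
Lemma lower_cov_matrix a b :
  (cov_matrix *m Gt (F x) *m ('J F x)^T) a b
  = \sum_l 'J v x a l * (\sum_k Gt (F x) l k * V b k)
    + 2^-1 * (derivative_form (V a) (v x 0) (V b)
              + derivative_form (v x 0) (V a) (V b)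
              - derivative_form (V b) (V a) (v x 0)).
Proof.
have symx k l : Gt (F x) k l = Gt (F x) l k.
  by rewrite -[in LHS]symGt mxE.
rewrite -mulmxA mulmxDl [LHS]mxE; congr (_ + _).
  rewrite [LHS]mxE; apply: eq_bigr => l _; rewrite [X in _ * X]mxE; congr (_ * _).
  by apply: eq_bigr => k _; rewrite [X in _ * X]mxE.
transitivity (\sum_l \sum_c \sum_d christoffel1 Gt (F x) l c d * V a c * v x 0 d * V b l);
  last first.
  symmetry; rewrite /derivative_form.
  have -> : \sum_i \sum_j \sum_k V a i * v x 0 j * V b k *
      pd i (fun y => Gt y j k) (F x) = \sum_l \sum_c \sum_d
      pd c (fun y => Gt y d l) (F x) * V a c * v x 0 d * V b l.
    under eq_bigr do rewrite exchange_big; rewrite exchange_big /=.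
    apply: eq_bigr => l _; apply: eq_bigr => c _; apply: eq_bigr => d _.
    by ring.
  have -> : \sum_i \sum_j \sum_k v x 0 i * V a j * V b k *
      pd i (fun y => Gt y j k) (F x) = \sum_l \sum_c \sum_d
      pd d (fun y => Gt y c l) (F x) * V a c * v x 0 d * V b l.
    rewrite exchange_big /=; under eq_bigr do rewrite exchange_big.
    rewrite exchange_big /=.
    apply: eq_bigr => l _; apply: eq_bigr => c _; apply: eq_bigr => d _.
    by ring.
  rewrite -big_split -sumrB mulr_sumr; apply: eq_bigr => l _ /=.
  rewrite -big_split -sumrB mulr_sumr; apply: eq_bigr => c _ /=.
  rewrite -big_split -sumrB mulr_sumr; apply: eq_bigr => d _ /=.
  by rewrite /christoffel1; ring.
rewrite mulmxA [LHS]mxE; apply: eq_bigr => l _; rewrite [X in _ * X]mxE [X in X * _]mxE.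
have low c d : \sum_k Gt (F x) l k * christoffel Gt (F x) k c d
    = christoffel1 Gt (F x) l c d.
  (* Lowering an index is an identity at a point, so a singleton serves as the domain. *)
  apply: (lower_christoffel (U := [set F x])) => // y -> //.
rewrite mulr_suml; under eq_bigr do rewrite [X in X * _ * _]mxE !mulr_suml.
rewrite exchange_big; apply: eq_bigr => c _ /=.
under eq_bigr do rewrite !mulr_suml.
rewrite exchange_big; apply: eq_bigr => d _ /=; rewrite -low !mulr_suml.
by apply: eq_bigr => k _; rewrite (symx l k); ring.
Qed.

End CovariantDerivative.

(** * The ambient metric and the immersion in one chart *)

Section AmbientMetric.
Context {R : realType} {n : nat}.

Local Notation N := (1 + (1 + n))%N.

Definition t_idx : 'I_N := lshift (1 + n) ord0.
Definition rho_idx : 'I_N := rshift 1 (lshift n ord0).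
Definition M_idx (k : 'I_n) : 'I_N := rshift 1 (rshift 1 k).

Lemma sum_amb (f : 'I_N -> R) :
  \sum_k f k = f t_idx + (f rho_idx + \sum_k f (M_idx k)).
Proof. by rewrite !big_split_ord /= !big_ord1. Qed.

Lemma idx_eqE :
  ((t_idx == rho_idx) = false) * ((rho_idx == t_idx) = false) *
  (forall k, (t_idx == M_idx k) = false) * (forall k, (M_idx k == t_idx) = false) *
  (forall k, (rho_idx == M_idx k) = false) *
  (forall k, (M_idx k == rho_idx) = false) *
  (forall k l, (M_idx k == M_idx l) = (k == l)).
Proof.
by do !split; move=> *; rewrite ?eq_lrshift ?eq_rlshift// !(inj_eq (@rshift_inj _ _))
  ?eq_lrshift ?eq_rlshift.
Qed.

Lemma t_crdE (y : 'rV[R]_N) : t_crd y = y 0 t_idx.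
Proof. by rewrite /t_crd mxE; congr (y _ _). Qed.

Lemma rho_crdE (y : 'rV[R]_N) : rho_crd y = y 0 rho_idx.
Proof. by rewrite /rho_crd !mxE; congr (y _ _). Qed.

Variables (G : 'rV[R]_n -> 'M[R]_n) (al : R -> 'rV[R]_n -> 'M[R]_n).

Definition fibre_metric (z : 'rV[R]_(1 + n)) : 'M[R]_n :=
  al (lsubmx z 0 0) (rsubmx z) *m G (rsubmx z).

(** One chart of [amb_metric], with the same body so that the two are convertible. *)
Definition ambient (y : 'rV[R]_N) : 'M[R]_N :=
  let drhot := dfun (fun z => rho_crd z * t_crd z) y in
  let dt := dfun t_crd y in
  otimes drhot dt + otimes dt drhot
  + t_crd y ^+ 2 *: block_mx 0 0 0
      (block_mx 0 0 0 (al (rho_crd y) (M_crd y) *m G (M_crd y))).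

Lemma dfun_t y k : dfun (@t_crd R n) y 0 k = (k == t_idx)%:R.
Proof.
rewrite mxE (_ : @t_crd R n = fun z : 'rV[R]_N => z 0 t_idx).
  by rewrite pd_coord eq_sym.
by apply/funext => z; exact: t_crdE.
Qed.

Lemma dfun_rho_t y k : dfun (fun z : 'rV[R]_N => rho_crd z * t_crd z) y 0 k
  = (k == rho_idx)%:R * y 0 t_idx + y 0 rho_idx * (k == t_idx)%:R.
Proof.
rewrite mxE; under eq_fun do rewrite rho_crdE t_crdE.
rewrite pdM; [|exact: differentiable_coord|exact: differentiable_coord].
by rewrite !pd_coord ![k == _]eq_sym.
Qed.

Let fibre_block (S : 'M[R]_n) : 'M[R]_N := block_mx 0 0 0 (block_mx 0 0 0 S).

Let fibre_blockE S :
  ((forall j, fibre_block S t_idx j = 0) * (forall j, fibre_block S j t_idx = 0) *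
  (forall j, fibre_block S rho_idx j = 0) * (forall j, fibre_block S j rho_idx = 0) *
  (forall k l, fibre_block S (M_idx k) (M_idx l) = S k l))%type.
Proof.
do !split; rewrite /fibre_block /t_idx /rho_idx /M_idx.
- by move=> j; case: (split_ordP j) => a ->; rewrite ?block_mxEul ?block_mxEur mxE.
- by move=> j; case: (split_ordP j) => a ->; rewrite ?block_mxEul ?block_mxEdl mxE.
- move=> j; case: (split_ordP j) => a ->; first by rewrite block_mxEdl mxE.
  by rewrite block_mxEdr; case: (split_ordP a) => b ->; rewrite ?block_mxEul ?block_mxEur mxE.
- move=> j; case: (split_ordP j) => a ->; first by rewrite block_mxEur mxE.
  by rewrite block_mxEdr; case: (split_ordP a) => b ->; rewrite ?block_mxEul ?block_mxEdl mxE.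
- by move=> k l; rewrite !block_mxEdr.
Qed.

Lemma ambientE y i j : ambient y i j =
  ((i == rho_idx)%:R * y 0 t_idx + y 0 rho_idx * (i == t_idx)%:R) * (j == t_idx)%:R
  + (i == t_idx)%:R * ((j == rho_idx)%:R * y 0 t_idx + y 0 rho_idx * (j == t_idx)%:R)
  + y 0 t_idx ^+ 2 * fibre_block (fibre_metric (rsubmx y)) i j.
Proof.
have otimesE (v w : 'rV[R]_N) : otimes v w i j = v 0 i * w 0 j.
  by rewrite mxE big_ord1 mxE.
rewrite [LHS]mxE [X in X + _]mxE !otimesE [X in _ + X]mxE.
by rewrite (dfun_t y i) (dfun_t y j) (dfun_rho_t y i) (dfun_rho_t y j) t_crdE.
Qed.

Lemma ambient_entries y :
  (((ambient y t_idx t_idx = 2 * y 0 rho_idx)%R *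
  (ambient y t_idx rho_idx = y 0 t_idx) * (ambient y rho_idx t_idx = y 0 t_idx) *
  (ambient y rho_idx rho_idx = 0) *
  (forall k, ambient y t_idx (M_idx k) = 0) *
  (forall k, ambient y (M_idx k) t_idx = 0) *
  (forall k, ambient y rho_idx (M_idx k) = 0) *
  (forall k, ambient y (M_idx k) rho_idx = 0))%type *
  (forall k l, ambient y (M_idx k) (M_idx l)
     = y 0 t_idx ^+ 2 * fibre_metric (rsubmx y) k l)%R)%type.
Proof.
by do !split; move=> *; rewrite ambientE !fibre_blockE ?idx_eqE ?eqxx /=
  ?mulr0n ?mulr1n; ring.
Qed.

Variable U : set 'rV[R]_n.
Hypotheses (oU : open U) (sG : smooth_mx_on U G).
Hypothesis symG : forall x, U x -> (G x)^T = G x.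
Hypothesis unitG : forall x, U x -> G x \in unitmx.
Hypothesis sal : smooth_mx_on [set z : 'rV[R]_(1 + n) | U (rsubmx z)]
  (fun z => al (lsubmx z 0 0) (rsubmx z)).
Hypothesis al0 : forall x, U x -> al 0 x = 1%:M.

Definition fibre_metric_deriv (x : 'rV[R]_n) (k l : 'I_n) : R :=
  derive1 (fun r => (al r x *m G x) k l) 0.

Definition amb_point (t : R) (x : 'rV[R]_n) : 'rV[R]_N :=
  row_mx t%:M (row_mx 0%:M x).

Lemma amb_pointE t x : (amb_point t x 0 t_idx = t) * (amb_point t x 0 rho_idx = 0)
  * (forall k, amb_point t x 0 (M_idx k) = x 0 k).
Proof.
rewrite /amb_point /t_idx /rho_idx /M_idx; split; [split|move=> k].
- by rewrite row_mxEl mxE eqxx mulr1n.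
- by rewrite row_mxEr row_mxEl mxE eqxx mulr1n.
- by rewrite !row_mxEr.
Qed.

Lemma smooth_fibre_metric :
  smooth_mx_on [set z : 'rV[R]_(1 + n) | U (rsubmx z)] fibre_metric.
Proof.
apply: smooth_mxM => //; first exact: open_rsubmx.
by move=> k l; exact: (smooth_rsubmx 1 oU (sG k l)).
Qed.

Lemma fibre_metric_slice r x : fibre_metric (row_mx r%:M x) = al r x *m G x.
Proof. by rewrite /fibre_metric row_mxKl row_mxKr mxE eqxx mulr1n. Qed.

Lemma fibre_metric0 x : U x -> fibre_metric (row_mx 0%:M x) = G x.
Proof. by move=> Ux; rewrite fibre_metric_slice al0// mul1mx. Qed.

Lemma pd_rho_fibre x k l :
  pd (lshift n ord0) (fun z => fibre_metric z k l) (row_mx 0%:M x)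
  = fibre_metric_deriv x k l.
Proof.
apply: (etrans (pd_line (fun z => fibre_metric z k l) 0 x)).
apply: (congr1 (fun f : R -> R => derive1 f 0)).
by apply/funext => r; rewrite fibre_metric_slice.
Qed.

(** On the slice [rho = 0] the fibre metric is [G], since the family starts at the identity, and
    derivatives along the slice see nothing else. *)
Lemma pd_M_fibre x k l j : U x ->
  pd (rshift 1 j) (fun z => fibre_metric z k l) (row_mx 0%:M x)
  = pd j (fun z => G z k l) x.
Proof.
move=> Ux; pose iota (z : 'rV[R]_n) : 'rV[R]_(1 + n) := row_mx 0%:M z.
have iotaD a h z :
    iota (h *: delta_mx 0 a + z) = h *: delta_mx 0 (@rshift 1 n a) + iota z.
  apply/rowP => i; rewrite [RHS]mxE [X in _ = X + _]mxE [X in _ = _ * X + _]mxE.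
  case: (split_ordP i) => b ->.
    by rewrite !row_mxEl eq_lrshift mulr0 add0r.
  by rewrite !row_mxEr !mxE (inj_eq (@rshift_inj _ _)).
apply: (etrans (esym (pd_slice iotaD (fun z => fibre_metric z k l) x j))).
by apply: (eq_pd_on _ oU Ux) => y Uy; rewrite fibre_metric0.
Qed.

Lemma differentiable_fibre_metric t x k l : U x ->
  differentiable (fun y : 'rV[R]_N => fibre_metric (rsubmx y) k l) (amb_point t x).
Proof.
move=> Ux; apply: (@differentiable_comp _ _ _ _ (@rsubmx R 1 1 (1 + n))
  (fun z => fibre_metric z k l)); first exact: differentiable_rsubmx.
rewrite row_mxKr; apply: smooth_differentiable (smooth_fibre_metric k l) _.
by rewrite /= row_mxKr.
Qed.

Lemma pd_ambient_MM t x k l i : U x ->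
  pd i (fun y => ambient y (M_idx k) (M_idx l)) (amb_point t x)
  = 2 * t * (t_idx == i)%:R * G x k l + t ^+ 2 *
    pd i (fun y : 'rV[R]_N => fibre_metric (rsubmx y) k l) (amb_point t x).
Proof.
move=> Ux; under eq_fun do rewrite ambient_entries.
have dt : differentiable (fun y : 'rV[R]_N => y 0 t_idx) (amb_point t x).
  exact: differentiable_coord.
rewrite (pdM i (differentiable_sq dt) (differentiable_fibre_metric t k l Ux)).
rewrite row_mxKr fibre_metric0//; under eq_fun do rewrite expr2.
by rewrite (pdM i dt dt) pd_coord amb_pointE expr2; ring.
Qed.

Lemma directional_MM (A : 'I_N -> R) t x k l : U x ->
  \sum_a A a * pd a (fun y => ambient y (M_idx k) (M_idx l)) (amb_point t x)
  = 2 * t * A t_idx * G x k l + t ^+ 2 * (A rho_idx * fibre_metric_deriv x k l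
     + \sum_j A (M_idx j) * pd j (fun z => G z k l) x).
Proof.
move=> Ux; pose f (y : 'rV[R]_N) := fibre_metric (rsubmx y) k l.
have ft : pd t_idx f (amb_point t x) = 0.
  exact: (pd_rsubmx_lshift (fun z => fibre_metric z k l)).
have fr : pd rho_idx f (amb_point t x) = fibre_metric_deriv x k l.
  apply: (etrans (pd_rsubmx_rshift (fun z => fibre_metric z k l) _ _)).
  by rewrite row_mxKr; exact: pd_rho_fibre.
have fM j : pd (M_idx j) f (amb_point t x) = pd j (fun z => G z k l) x.
  apply: (etrans (pd_rsubmx_rshift (fun z => fibre_metric z k l) _ _)).
  by rewrite row_mxKr; exact: pd_M_fibre.
have E i := pd_ambient_MM t k l i Ux.
rewrite sum_amb !E ft fr !idx_eqE eqxx.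
have -> : \sum_j A (M_idx j) *
      pd (M_idx j) (fun y => ambient y (M_idx k) (M_idx l)) (amb_point t x)
    = t ^+ 2 * \sum_j A (M_idx j) * pd j (fun z => G z k l) x.
  rewrite mulr_sumr; apply: eq_bigr => j _; rewrite E fM idx_eqE /= mulr0n.
  by ring.
by rewrite /= mulr1n mulr0n; ring.
Qed.

(** The nonzero entries of the metric are [2 rho], [t] and [t^2] times the fibre metric; each group
    on the right is the derivative of one of them along [A]. *)
Lemma trilinear_ambient (A B C : 'I_N -> R) t x : U x ->
  \sum_a \sum_b \sum_c
    A a * B b * C c * pd a (fun y => ambient y b c) (amb_point t x)
  = 2 * A rho_idx * B t_idx * C t_idx
    + A t_idx * (B t_idx * C rho_idx + B rho_idx * C t_idx)
    + \sum_k \sum_l B (M_idx k) * C (M_idx l) *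
        (2 * t * A t_idx * G x k l + t ^+ 2 * (A rho_idx * fibre_metric_deriv x k l
          + \sum_j A (M_idx j) * pd j (fun z => G z k l) x)).
Proof.
move=> Ux.
pose E b c := \sum_a A a * pd a (fun y => ambient y b c) (amb_point t x).
have -> : \sum_a \sum_b \sum_c
    A a * B b * C c * pd a (fun y => ambient y b c) (amb_point t x)
  = \sum_b \sum_c B b * C c * E b c.
  rewrite exchange_big; apply: eq_bigr => b _ /=; rewrite exchange_big.
  apply: eq_bigr => c _ /=; rewrite /E mulr_sumr; apply: eq_bigr => a _.
  by ring.
have Ecoord b c j r : (forall y, ambient y b c = r * y 0 j) -> E b c = r * A j.
  move=> F; rewrite /E -(sum_deltaC A j) mulr_sumr; apply: eq_bigr => a _.
  under eq_fun do rewrite F.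
  by rewrite pdZ ?pd_coord; [ring | exact: differentiable_coord].
have E0 b c : (forall y, ambient y b c = 0) -> E b c = 0.
  move=> F; rewrite /E big1// => a _; under eq_fun do rewrite F.
  by rewrite pd_cst mulr0.
have Ett : E t_idx t_idx = 2 * A rho_idx.
  by apply: Ecoord => y; rewrite ambient_entries.
have Etr : E t_idx rho_idx = 1 * A t_idx.
  by apply: Ecoord => y; rewrite ambient_entries mul1r.
have Ert : E rho_idx t_idx = 1 * A t_idx.
  by apply: Ecoord => y; rewrite ambient_entries mul1r.
have Err : E rho_idx rho_idx = 0 by apply: E0 => y; rewrite ambient_entries.
have EtM k : E t_idx (M_idx k) = 0 by apply: E0 => y; rewrite ambient_entries.
have EMt k : E (M_idx k) t_idx = 0 by apply: E0 => y; rewrite ambient_entries.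
have ErM k : E rho_idx (M_idx k) = 0 by apply: E0 => y; rewrite ambient_entries.
have EMr k : E (M_idx k) rho_idx = 0 by apply: E0 => y; rewrite ambient_entries.
have sumM0 (f g : 'I_n -> R) : (forall k, f k = 0) -> \sum_k g k * f k = 0.
  by move=> f0; rewrite big1// => k _; rewrite f0 mulr0.
rewrite sum_amb !sum_amb Ett Etr Ert Err.
rewrite (sumM0 (fun k => E t_idx (M_idx k)))// (sumM0 (fun k => E rho_idx (M_idx k)))//.
have -> : \sum_k \sum_c B (M_idx k) * C c * E (M_idx k) c = \sum_k \sum_l
    B (M_idx k) * C (M_idx l) * (2 * t * A t_idx * G x k l
     + t ^+ 2 * (A rho_idx * fibre_metric_deriv x k l
          + \sum_j A (M_idx j) * pd j (fun z => G z k l) x)).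
  apply: eq_bigr => k _; rewrite sum_amb EMt EMr !mulr0 !add0r.
  by apply: eq_bigr => l _; rewrite /E directional_MM.
by ring.
Qed.

Lemma amb_idxP (P : 'I_N -> Prop) :
  P t_idx -> P rho_idx -> (forall k, P (M_idx k)) -> forall i, P i.
Proof.
move=> Pt Pr PM i; case: (split_ordP i) => a ->; first by rewrite [a]ord1.
by case: (split_ordP a) => b ->; [rewrite [b]ord1 | exact: PM].
Qed.

Lemma ambient_sym t x : U x -> (ambient (amb_point t x))^T = ambient (amb_point t x).
Proof.
move=> Ux; apply/matrixP => i j; rewrite [LHS]mxE; move: i j.
have symx k l : G x k l = G x l k := metricC symG k l Ux.
by apply: amb_idxP; [| |move=> k]; apply: amb_idxP; [| |move=> l| | |move=> l| | |move=> l];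
  rewrite !ambient_entries// row_mxKr fibre_metric0// symx.
Qed.

(** For a row in the kernel, the [rho] column kills the [t] component; as [rho = 0], the [t] column
    then kills the [rho] component, and the rest is a kernel vector of [G]. *)
Lemma ambient_unit t x : t != 0 -> U x -> ambient (amb_point t x) \in unitmx.
Proof.
move=> t0 Ux; rewrite -row_free_unit; apply: inj_row_free => v vA.
have E j : \sum_k v 0 k * ambient (amb_point t x) k j = 0.
  by have := congr1 (fun M : 'rV[R]_N => M 0 j) vA; rewrite !mxE.
have vt : v 0 t_idx = 0.
  have := E rho_idx; rewrite sum_amb !ambient_entries amb_pointE mulr0 add0r.
  rewrite big1 ?addr0 => [/eqP|k _]; last by rewrite ambient_entries mulr0.
  by rewrite mulf_eq0 (negbTE t0) orbF => /eqP.
have vr : v 0 rho_idx = 0.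
  have := E t_idx; rewrite sum_amb !ambient_entries !amb_pointE mulr0 mulr0 add0r.
  rewrite big1 ?addr0 => [/eqP|k _]; last by rewrite ambient_entries mulr0.
  by rewrite mulf_eq0 (negbTE t0) orbF => /eqP.
have vM : \row_k v 0 (M_idx k) = 0.
  apply: (can_inj (mulmxK (unitG Ux))); rewrite mul0mx; apply/rowP => l.
  have := E (M_idx l); rewrite sum_amb !ambient_entries !mulr0 !add0r.
  under eq_bigr do rewrite ambient_entries row_mxKr fibre_metric0// amb_pointE mulrCA.
  rewrite -mulr_sumr => /eqP; rewrite mulf_eq0 expf_eq0 (negbTE t0) andbF /= => /eqP s.
  by rewrite !mxE -[RHS]s; apply: eq_bigr => k _; rewrite mxE.
apply/rowP => i; rewrite mxE; move: i; apply: amb_idxP => // k.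
by have /rowP/(_ k) := vM; rewrite !mxE.
Qed.

Lemma sum_ambM (f g : 'I_N -> R) gt gr gM :
  g t_idx = gt -> g rho_idx = gr -> (forall k, g (M_idx k) = gM k) ->
  \sum_k f k * g k
  = f t_idx * gt + (f rho_idx * gr + \sum_k f (M_idx k) * gM k).
Proof.
by move=> <- <- gE; rewrite sum_amb; under [in LHS]eq_bigr do rewrite gE.
Qed.

Lemma trilinear_ambient_at (A B C : 'I_N -> R) At Ar AM Bt Br BM Ct Cr CM t x :
  U x ->
  A t_idx = At -> A rho_idx = Ar -> (forall k, A (M_idx k) = AM k) ->
  B t_idx = Bt -> B rho_idx = Br -> (forall k, B (M_idx k) = BM k) ->
  C t_idx = Ct -> C rho_idx = Cr -> (forall k, C (M_idx k) = CM k) ->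
  \sum_a \sum_b \sum_c
    A a * B b * C c * pd a (fun y => ambient y b c) (amb_point t x)
  = 2 * Ar * Bt * Ct + At * (Bt * Cr + Br * Ct)
    + \sum_k \sum_l BM k * CM l *
        (2 * t * At * G x k l + t ^+ 2 * (Ar * fibre_metric_deriv x k l
          + \sum_j AM j * pd j (fun z => G z k l) x)).
Proof.
move=> Ux <- <- AE <- <- BE <- <- CE; rewrite trilinear_ambient//; congr (_ + _).
apply: eq_bigr => k _; apply: eq_bigr => l _; rewrite BE CE.
by under eq_bigr do rewrite AE.
Qed.

Variable u : 'rV[R]_n -> R.
Hypothesis su : smooth_on U u.

Local Notation w x := (grad G u x 0).

Definition psi_loc (z : 'rV[R]_n) : 'rV[R]_N := amb_point (expR (u z)) z.

Definition eta_loc (z : 'rV[R]_n) : 'rV[R]_N :=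
  (expR (- u z) * (sqnorm G z (grad G u z) / 2)) *: d_t
  - expR (- (2 * u z)) *: d_rho + expR (- (2 * u z)) *: lift_vec (grad G u z).

Lemma eta_locE z :
  (eta_loc z 0 t_idx = expR (- u z) * (sqnorm G z (grad G u z) / 2)) *
  (eta_loc z 0 rho_idx = - expR (- (2 * u z))) *
  (forall k, eta_loc z 0 (M_idx k) = expR (- (2 * u z)) * w z k).
Proof.
have E k : eta_loc z 0 k = (expR (- u z) * (sqnorm G z (grad G u z) / 2)) * d_t 0 k
    - expR (- (2 * u z)) * d_rho 0 k + expR (- (2 * u z)) * lift_vec (grad G u z) 0 k.
  rewrite mxE [X in X + _]mxE [X in X + _ + _]mxE [X in _ + X]mxE.
  by rewrite [X in _ + X + _]mxE [X in _ - X + _]mxE.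
rewrite !E /d_t /d_rho /lift_vec /t_idx /rho_idx /M_idx.
split; [split|move=> k; rewrite E]; rewrite ?(row_mxEl, row_mxEr) !mxE ?eqxx /=;
  by rewrite ?mulr1n ?mulr0n; ring.
Qed.

Let dux x (Ux : U x) : differentiable u x := smooth_differentiable su Ux.

Let dw x k (Ux : U x) : differentiable (fun z => w z k) x :=
  smooth_differentiable (smooth_grad oU sG unitG su 0 k) Ux.

Let dexp r x (Ux : U x) : differentiable (fun z => expR (r * u z)) x.
Proof.
apply/differentiable_expR/differentiableMf; last exact: dux.
exact: differentiable_cstf.
Qed.

Lemma differentiable_psi x : U x -> differentiable psi_loc x.
Proof.
move=> Ux; apply: differentiable_rV; apply: amb_idxP => [||k].
- by under eq_fun do rewrite amb_pointE; exact/differentiable_expR/dux.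
- by under eq_fun do rewrite amb_pointE; exact: differentiable_cstf.
- by under eq_fun do rewrite amb_pointE; exact: differentiable_coord.
Qed.

Lemma differentiable_eta x : U x -> differentiable eta_loc x.
Proof.
move=> Ux; apply: differentiable_rV; apply: amb_idxP => [||k].
- under eq_fun do rewrite eta_locE; apply: differentiableMf.
    exact/differentiable_expR/differentiableNf/dux.
  apply: differentiableMf; last exact: differentiable_cstf.
  exact: smooth_differentiable (smooth_sqnorm_grad oU sG unitG su) Ux.
- under eq_fun do rewrite eta_locE -mulNr; exact/differentiableNf/dexp.
- under eq_fun do rewrite eta_locE -mulNr.
  by apply: differentiableMf; [exact: dexp|exact: dw].
Qed.

Let dpsi x a (Ux : U x) :
  (('J psi_loc x a t_idx = expR (u x) * pd a u x)%R *
  ('J psi_loc x a rho_idx = 0) *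
  (forall k, 'J psi_loc x a (M_idx k) = (k == a)%:R))%type.
Proof.
have E k := jacobianE a k (differentiable_psi Ux).
split; [split|move=> k]; rewrite E; under eq_fun do rewrite amb_pointE.
- exact: pd_expR (dux Ux).
- exact: pd_cst.
- exact: pd_coord.
Qed.

Let pd_exp_neg x a (Ux : U x) : pd a (fun z => expR (- (2 * u z))) x
  = - 2 * expR (- (2 * u x)) * pd a u x.
Proof.
under eq_fun do rewrite -mulNr.
have d2u : differentiable (fun z => - 2 * u z) x.
  by apply: differentiableMf (dux Ux); exact: differentiable_cstf.
by rewrite (pd_expR a d2u) (pdZ a _ (dux Ux)) mulNr; ring.
Qed.

Let deta_rho x a (Ux : U x) :
  'J eta_loc x a rho_idx = 2 * expR (- (2 * u x)) * pd a u x.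
Proof.
rewrite (jacobianE a _ (differentiable_eta Ux)).
under eq_fun do rewrite eta_locE.
rewrite pdN ?pd_exp_neg//; first by ring.
by under eq_fun do rewrite -mulNr; exact: dexp.
Qed.

Let deta_M x a k (Ux : U x) :
  'J eta_loc x a (M_idx k)
  = expR (- (2 * u x)) * (pd a (fun z => w z k) x - 2 * pd a u x * w x k).
Proof.
rewrite (jacobianE a _ (differentiable_eta Ux)).
under eq_fun do rewrite eta_locE.
have de : differentiable (fun z => expR (- (2 * u z))) x.
  by under eq_fun do rewrite -mulNr; exact: dexp.
by rewrite (pdM a de (dw k Ux)) pd_exp_neg//; ring.
Qed.

Definition weingarten_form (x : 'rV[R]_n) : 'M[R]_n :=
  2^-1 *: \matrix_(k, l) fibre_metric_deriv x k l
  - (sqnorm G x (grad G u x) / 2) *: G x - hess G u x + (dfun u x)^T *m dfun u x.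

Lemma weingarten_formE x a b : weingarten_form x a b
  = 2^-1 * fibre_metric_deriv x a b - sqnorm G x (grad G u x) / 2 * G x a b
    - hess G u x a b + pd a u x * pd b u x.
Proof. by rewrite !mxE big_ord1 !mxE. Qed.

Let sum_deltal (f : 'I_n -> 'I_n -> R) (C : 'I_n -> R) a :
  \sum_k \sum_l (k == a)%:R * C l * f k l = \sum_l C l * f a l.
Proof.
rewrite -[RHS](sum_delta (fun k => \sum_l C l * f k l)).
by apply: eq_bigr => k _; rewrite mulr_sumr; apply: eq_bigr => l _; rewrite mulrA.
Qed.

Let sum_deltar (f : 'I_n -> 'I_n -> R) (C : 'I_n -> R) b :
  \sum_k \sum_l C k * (l == b)%:R * f k l = \sum_k C k * f k b.
Proof.
apply: eq_bigr => k _; rewrite -[RHS](sum_delta (fun l => C k * f k l)).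
by apply: eq_bigr => l _; ring.
Qed.

Opaque jacobian ambient amb_point eta_loc fibre_metric grad.

Let W x b l := \sum_k ambient (psi_loc x) l k * 'J psi_loc x b k.

(** The lowered tangent vectors have no [t] component because the immersion stays in [rho = 0].
    Hence the derivative of the [t] component of [eta_loc], which involves that of the squared
    gradient, never enters. *)
Lemma lower_tangent x b : U x -> [/\ W x b t_idx = 0,
  W x b rho_idx = expR (u x) * expR (u x) * pd b u x &
  forall k, W x b (M_idx k) = expR (u x) * expR (u x) * G x k b].
Proof.
move=> Ux; split=> [||k];
  apply: (etrans (sum_ambM _ (dpsi b Ux).1.1 (dpsi b Ux).1.2 (dpsi b Ux).2)).
- rewrite !ambient_entries !amb_pointE.
  rewrite big1 => [|k _]; last by rewrite ambient_entries mul0r.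
  by ring.
- rewrite !ambient_entries !amb_pointE.
  rewrite big1 => [|k _]; last by rewrite ambient_entries mul0r.
  by ring.
- rewrite !ambient_entries !mul0r !add0r.
  rewrite -[RHS](sum_delta (fun l => expR (u x) * expR (u x) * G x k l)).
  apply: eq_bigr => l _; rewrite ambient_entries !amb_pointE row_mxKr fibre_metric0//.
  by rewrite expr2 mulrC.
Qed.

Lemma first_fundamental_form x : U x ->
  'J psi_loc x *m ambient (psi_loc x) *m ('J psi_loc x)^T = expR (2 * u x) *: G x.
Proof.
move=> Ux; apply/matrixP => a b; have [Wt Wr WM] := lower_tangent b Ux.
have -> : expR (2 * u x) = expR (u x) * expR (u x).
  by rewrite -expRD; congr expR; ring.
rewrite -mulmxA [LHS]mxE [RHS]mxE.
transitivity (\sum_l 'J psi_loc x a l * W x b l).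
  apply: eq_bigr => l _; congr (_ * _); rewrite mxE; apply: eq_bigr => k _.
  by rewrite [X in _ * X]mxE.
apply: (etrans (sum_ambM _ Wt Wr WM)); rewrite mulr0 add0r.
rewrite (dpsi a Ux).1.2 mul0r add0r.
rewrite -[RHS](sum_delta (fun k => expR (u x) * expR (u x) * G x k b)).
by apply: eq_bigr => k _; rewrite (dpsi a Ux).2.
Qed.

(** By [lower_cov_matrix] the left-hand side is a derivative of [eta_loc] plus half of three
    derivatives of the metric. The sums [P], [S1], [S2], [S3] that they produce are those of the
    Hessian of [u]. *)
Lemma ambient_weingarten x : U x ->
  cov_matrix ambient psi_loc eta_loc x *m ambient (psi_loc x) *m ('J psi_loc x)^T
  = - weingarten_form x.
Proof.
move=> Ux; apply/matrixP => a b.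
have e0 : expR (u x) != 0 := expR_neq0 (u x).
have lowc c (y : R) : \sum_k y * w x k * G x k c = y * pd c u x.
  rewrite -(lower_grad symG unitG u c Ux) mulr_sumr; apply: eq_bigr => k _.
  by rewrite (metricC symG k c Ux); ring.
pose S1 := \sum_k w x k * pd a (fun z => G z k b) x.
pose S2 := \sum_j w x j * pd j (fun z => G z a b) x.
pose S3 := \sum_l w x l * pd b (fun z => G z a l) x.
pose P := \sum_k pd a (fun z => w z k) x * G x k b.
pose e2 := expR (- (2 * u x)).
(* The only relation between the exponentials that most of the identities below use; elsewhere they
   are treated as independent atoms. *)
have ee2 : expR (u x) * expR (u x) * e2 = 1.
  rewrite -expRD -expRD (_ : u x + u x - 2 * u x = 0) ?expR0//; ring.
(* The factor [e^{-2u}] is differentiated in the [rho] and in the [M] components; the resulting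
   products of [pd a u] and [pd b u] cancel. *)
have T1 : \sum_l 'J eta_loc x a l * (\sum_k ambient (psi_loc x) l k * 'J psi_loc x b k)
    = P.
  have [Wt Wr WM] := lower_tangent b Ux.
  apply: (etrans (sum_ambM ('J eta_loc x a) Wt Wr WM)).
  rewrite mulr0 add0r (deta_rho a Ux).
  have -> : \sum_k 'J eta_loc x a (M_idx k) * (expR (u x) * expR (u x) * G x k b)
    = (expR (u x) * expR (u x) * e2) * (P - 2 * (pd a u x * pd b u x)).
    rewrite [2 * _]mulrA -lowc /P -sumrB mulr_sumr.
    by apply: eq_bigr => k _; rewrite deta_M// -/e2; ring.
  rewrite -/e2 ee2 mul1r; move: ee2 (pd a u x) (pd b u x) => H ua ub.
  transitivity (2 * (expR (u x) * expR (u x) * e2) * (ua * ub) + (P - 2 * (ua * ub))).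
    by move: P e2 (expR _) {H} => p f e; ring.
  by rewrite H; move: P => p; ring.
have Ja := dpsi a Ux; have Jb := dpsi b Ux; have Je := eta_locE x.
have D1 : derivative_form ambient psi_loc x ('J psi_loc x a) (eta_loc x 0)
    ('J psi_loc x b) = pd a u x * pd b u x + S1.
  apply: (etrans (trilinear_ambient_at (expR (u x)) Ux Ja.1.1 Ja.1.2 Ja.2
    Je.1.1 Je.1.2 Je.2 Jb.1.1 Jb.1.2 Jb.2)).
  rewrite (_ : \sum_k _ = expR (u x) * expR (u x) * e2
    * (2 * pd a u x * pd b u x + S1)).
    rewrite -/e2 ee2 mul1r; move: (pd a u x) (pd b u x) (expR (- u x) * _) => ua ub et.
    transitivity (- (expR (u x) * expR (u x) * e2) * (ua * ub) + (2 * ua * ub + S1)).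
      by move: S1 e2 (expR (u x)) {ee2} => s f e; ring.
    by rewrite ee2; move: S1 => s; ring.
  rewrite sum_deltar -(lowc b (2 * pd a u x)) /S1 -big_split mulr_sumr; apply: eq_bigr => k _ /=.
  by rewrite sum_delta -/e2; ring.
(* The direction is now [eta_loc], the only one with a [rho] component: its [-e^{-2u}] against
   [t^2 = e^{2u}] brings in the derivative of the family with coefficient -1. Its [t] component
   gives the squared gradient. *)
have D2 : derivative_form ambient psi_loc x (eta_loc x 0) ('J psi_loc x a)
    ('J psi_loc x b) = - 2 * (pd a u x * pd b u x)
    + sqnorm G x (grad G u x) * G x a b - fibre_metric_deriv x a b + S2.
  apply: (etrans (trilinear_ambient_at (expR (u x)) Ux 
    Je.1.1 Je.1.2 Je.2 Ja.1.1 Ja.1.2 Ja.2 Jb.1.1 Jb.1.2 Jb.2)).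
  rewrite sum_deltar sum_delta -/e2.
  rewrite (_ : \sum_j _ = e2 * S2); last first.
    by rewrite /S2 mulr_sumr; apply: eq_bigr => j _; rewrite -mulrA.
  rewrite expRN.
  have eV : expR (u x) * (expR (u x))^-1 = 1 by rewrite divff.
  move: (pd a u x) (pd b u x) (sqnorm _ _ _) (G x a b) (fibre_metric_deriv _ _ _).
  move=> ua ub q Gab d.
  transitivity (- 2 * (expR (u x) * expR (u x) * e2) * (ua * ub)
    + expR (u x) * (expR (u x))^-1 * (q * Gab)
    + expR (u x) * expR (u x) * e2 * (S2 - d)).
    by move: S2 e2 (expR (u x)) e0 {ee2 eV} => s f e e0; field.
  by rewrite ee2 eV; move: S2 => s; ring.
have D3 : derivative_form ambient psi_loc x ('J psi_loc x b) ('J psi_loc x a)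
    (eta_loc x 0) = pd a u x * pd b u x + S3.
  apply: (etrans (trilinear_ambient_at (expR (u x)) Ux Jb.1.1 Jb.1.2 Jb.2
     Ja.1.1 Ja.1.2 Ja.2 Je.1.1 Je.1.2 Je.2)).
  rewrite (_ : \sum_k _ = expR (u x) * expR (u x) * e2
    * (2 * pd b u x * pd a u x + S3)).
    rewrite -/e2 ee2 mul1r; move: (pd a u x) (pd b u x) (expR (- u x) * _) => ua ub et.
    transitivity (- (expR (u x) * expR (u x) * e2) * (ua * ub) + (2 * ub * ua + S3)).
      by move: S3 e2 (expR (u x)) {ee2} => s f e; ring.
    by rewrite ee2; move: S3 => s; ring.
  rewrite sum_deltal -(lowc a (2 * pd b u x)) /S3 -big_split mulr_sumr; apply: eq_bigr => k _ /=.
  by rewrite sum_delta -/e2 (metricC symG a k Ux); ring.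
apply: (etrans (@lower_cov_matrix _ _ _ ambient psi_loc eta_loc x
  (ambient_sym _ Ux) (ambient_unit e0 Ux) a b)).
apply: (etrans (congr2 +%R T1 (congr1 ( *%R 2^-1)
  (congr2 (fun p q => p - q) (congr2 +%R D1 D2) D3)))).
(* Differentiating [du = G w] once more expresses the second derivative of [u] by [P] and [S1]. *)
have HE : hess G u x a b = P + S1 - 2^-1 * (S1 + S3 - S2).
  apply: (etrans (hess_christoffel1 symG unitG u a b Ux)).
  congr (_ - _).
    rewrite (eq_pd_on (f := pd b u) a oU Ux (fun y Uy =>
      esym (lower_grad symG unitG u b Uy))).
    have dG k := metric_differentiable sG b k Ux.
    rewrite pd_sum => [|k]; last exact: differentiableMf (dG k) (dw k Ux).
    rewrite /P /S1 -big_split; apply: eq_bigr => k _ /=.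
    rewrite (pdM a (dG k) (dw k Ux)) (pd_metricC oU symG b k a Ux).
    by rewrite (metricC symG b k Ux); ring.
  rewrite /S1 /S2 /S3 -big_split -sumrB mulr_sumr; apply: eq_bigr => k _ /=.
  by rewrite /christoffel1 (pd_metricC oU symG b k a Ux); ring.
rewrite [RHS]mxE weingarten_formE HE.
move: (sqnorm _ _ _) (G x a b) (fibre_metric_deriv _ _ _) (pd a u x) (pd b u x).
clear HE T1 D1 D2 D3; move: P S1 S2 S3 => p s1 s2 s3 s g d ua ub.
by field.
Qed.

End AmbientMetric.

(** * The Weingarten form *)

Section MatrixCurves.
Context {R : realType}.

Definition curve_deriv p q (F : R -> 'M[R]_(p, q)) : 'M[R]_(p, q) :=
  \matrix_(a, b) derive1 (fun r => F r a b) 0.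

Lemma derive1_sum_mull n (f : 'I_n -> R -> R) (c : 'I_n -> R) :
  (forall k, derivable (f k) 0 1) ->
  derive1 (fun r => \sum_k c k * f k r) 0 = \sum_k c k * derive1 (f k) 0.
Proof.
move=> df; rewrite derive1E.
have -> : (fun r => \sum_k c k * f k r) = \sum_k (c k \*: f k).
  by apply/funext => r; rewrite fct_sumE.
rewrite derive_sum => [|k]; last exact: derivableZ.
by apply: eq_bigr => k _; rewrite deriveZ// derive1E.
Qed.

Lemma curve_derivMl p q n (C : 'M[R]_(p, q)) (F : R -> 'M[R]_(q, n)) :
  (forall a b, derivable (fun r => F r a b) 0 1) ->
  curve_deriv (fun r => C *m F r) = C *m curve_deriv F.
Proof.
move=> dF; apply/matrixP => a b; rewrite !mxE; under eq_fun do rewrite mxE.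
by rewrite derive1_sum_mull//; apply: eq_bigr => k _; rewrite mxE.
Qed.

Lemma curve_derivMr p q n (F : R -> 'M[R]_(p, q)) (C : 'M[R]_(q, n)) :
  (forall a b, derivable (fun r => F r a b) 0 1) ->
  curve_deriv (fun r => F r *m C) = curve_deriv F *m C.
Proof.
move=> dF; apply/matrixP => a b; rewrite !mxE.
under eq_fun do (rewrite mxE; under eq_bigr do rewrite mulrC).
by rewrite derive1_sum_mull//; apply: eq_bigr => k _; rewrite mxE mulrC.
Qed.

Lemma curve_deriv_tr p q (F : R -> 'M[R]_(p, q)) :
  curve_deriv (fun r => (F r)^T) = (curve_deriv F)^T.
Proof. by apply/matrixP => a b; rewrite !mxE; under eq_fun do rewrite mxE. Qed.

End MatrixCurves.

Section SumOfFunctions.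
Context {R : realType} {n : nat}.
Variables (U : set 'rV[R]_n) (G : 'rV[R]_n -> 'M[R]_n) (u v : 'rV[R]_n -> R).
Hypotheses (oU : open U).
Hypothesis symG : forall x, U x -> (G x)^T = G x.
Hypothesis unitG : forall x, U x -> G x \in unitmx.
Hypotheses (su : smooth_on U u) (sv : smooth_on U v).

Local Notation uv := (fun y => u y + v y).

Lemma dfun_add x : U x -> dfun uv x = dfun u x + dfun v x.
Proof.
move=> Ux; apply/rowP => k; rewrite !mxE.
exact: pdD (smooth_differentiable su Ux) (smooth_differentiable sv Ux).
Qed.

Lemma grad_add x : U x -> grad G uv x = grad G u x + grad G v x.
Proof. by move=> Ux; rewrite /grad dfun_add// mulmxDl. Qed.

Opaque grad.

Lemma hess_add x : U x -> hess G uv x = hess G u x + hess G v x.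
Proof.
move=> Ux; apply/matrixP => a b; rewrite !mxE.
have E k y : U y -> pd k uv y = pd k u y + pd k v y.
  by move=> Uy; exact: pdD (smooth_differentiable su Uy) (smooth_differentiable sv Uy).
have -> : pd a (pd b uv) x = pd a (pd b u) x + pd a (pd b v) x.
  rewrite (eq_pd_on a oU Ux (E b)).
  exact: pdD (smooth_differentiable (smooth_pd b su) Ux)
    (smooth_differentiable (smooth_pd b sv) Ux).
under eq_bigr do rewrite E// mulrDr.
rewrite big_split /=; move: (\sum_k _) (\sum_k _) (pd a (pd b u) x) => s t p.
by move: (pd a (pd b v) x) => q; ring.
Qed.

Lemma sqnorm_grad_add x : U x ->
  sqnorm G x (grad G uv x) = sqnorm G x (grad G u x) + sqnorm G x (grad G v x)
    + 2 * \sum_k pd k v x * grad G u x 0 k.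
Proof.
move=> Ux; rewrite !(sqnorm_gradE symG unitG)// grad_add//.
have dotC : \sum_k pd k u x * grad G v x 0 k = \sum_k pd k v x * grad G u x 0 k.
  under eq_bigr do rewrite gradE mulr_sumr.
  rewrite exchange_big; apply: eq_bigr => l _ /=; rewrite gradE mulr_sumr.
  by apply: eq_bigr => k _; rewrite (invmetricC symG l k Ux); ring.
have E k : pd k uv x * (grad G u x + grad G v x) 0 k
    = pd k u x * grad G u x 0 k + pd k v x * grad G v x 0 k
      + (pd k u x * grad G v x 0 k + pd k v x * grad G u x 0 k).
  rewrite [pd k uv x](_ : _ = pd k u x + pd k v x); last first.
    exact: pdD (smooth_differentiable su Ux) (smooth_differentiable sv Ux).
  by rewrite [X in _ * X = _]mxE; ring.
rewrite (eq_bigr _ (fun k _ => E k)) !big_split /= dotC.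
by move: (\sum_k _) (\sum_k _) (\sum_k _) => *; ring.
Qed.

End SumOfFunctions.

Section LocalMoebius.
Context {R : realType} {n : nat}.
Variables (U : set 'rV[R]_n) (G : 'rV[R]_n -> 'M[R]_n) (al : R -> 'rV[R]_n -> 'M[R]_n).
Hypotheses (oU : open U) (sG : smooth_mx_on U G).
Hypothesis symG : forall x, U x -> (G x)^T = G x.
Hypothesis unitG : forall x, U x -> G x \in unitmx.
Hypothesis sal : smooth_mx_on [set z : 'rV[R]_(1 + n) | U (rsubmx z)]
  (fun z => al (lsubmx z 0 0) (rsubmx z)).
Variable u : 'rV[R]_n -> R.
Hypothesis su : smooth_on U u.

Let Gu : 'rV[R]_n -> 'M[R]_n := fun x => expR (2 * u x) *: G x.

Lemma derivable_family x a b : U x -> derivable (fun r => al r x a b) 0 1.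
Proof.
move=> Ux; pose f (z : 'rV[R]_(1 + n)) := al (lsubmx z 0 0) (rsubmx z) a b.
have -> : (fun r => al r x a b) = (fun r => f (row_mx r%:M x)).
  by apply/funext => r; rewrite /f row_mxKl row_mxKr mxE eqxx mulr1n.
apply: derivable_line; apply: smooth_differentiable (sal a b) _.
by rewrite /= row_mxKr.
Qed.

Lemma fibre_metric_derivE x : U x ->
  \matrix_(k, l) fibre_metric_deriv G al x k l = curve_deriv (al ^~ x) *m G x.
Proof. by move=> Ux; rewrite -curve_derivMr// => a b; exact: derivable_family. Qed.

(** A derivative in the parameter is a partial derivative of a function smooth in [(rho, x)]
    jointly, restricted to the slice [rho = 0]. *)
Lemma smooth_fibre_metric_deriv k l : smooth_on U (fun x => fibre_metric_deriv G al x k l).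
Proof.
pose iota (z : 'rV[R]_n) : 'rV[R]_(1 + n) := row_mx 0%:M z.
have sf := smooth_pd (lshift n ord0) (smooth_fibre_metric oU sG sal k l).
have -> : (fun x => fibre_metric_deriv G al x k l) =
    (fun x => pd (lshift n ord0) (fun z => fibre_metric G al z k l) (iota x)).
  by apply/funext => x; rewrite /iota pd_rho_fibre.
apply: (smooth_slice (sigma := @rshift 1 n) _ _ _ sf).
- move=> a h z; apply/rowP => i.
  rewrite [RHS]mxE [X in _ = X + _]mxE [X in _ = _ * X + _]mxE /iota.
  case: (split_ordP i) => b ->.
    by rewrite !row_mxEl eq_lrshift mulr0 add0r.
  by rewrite !row_mxEr !mxE (inj_eq (@rshift_inj _ _)).
- move=> x; apply: differentiable_rV => i; case: (split_ordP i) => b ->.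
    under eq_fun do rewrite row_mxEl; exact: differentiable_cst.
  under eq_fun do rewrite row_mxEr; exact: differentiable_coord.
- by move=> x Ux; rewrite /= /iota row_mxKr.
Qed.

Lemma smooth_weingarten_form : smooth_mx_on U (weingarten_form G al u).
Proof.
apply: smooth_mxD => //; first apply: smooth_mxD => //; first apply: smooth_mxD => //.
- apply: smooth_mxZ => //; first exact: smooth_cst.
  by move=> k l; under eq_fun do rewrite mxE; exact: smooth_fibre_metric_deriv.
- apply: smooth_mxN => //; apply: smooth_mxZ => //; apply: smoothM => //.
    exact: smooth_sqnorm_grad.
  exact: smooth_cst.
- by apply: smooth_mxN => //; exact: smooth_hess.
- have sd : smooth_mx_on U (dfun u).
    by move=> i k; under eq_fun do rewrite mxE; exact: smooth_pd.
  by apply: smooth_mxM => //; exact: smooth_tr.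
Qed.

(** Symmetry of the first term comes from differentiating the self-adjointness of the family at
    0. *)
Lemma weingarten_form_sym x :
  (forall r, al r x *m G x = G x *m (al r x)^T) -> U x ->
  (weingarten_form G al u x)^T = weingarten_form G al u x.
Proof.
move=> adj Ux; apply/matrixP => a b; rewrite mxE !weingarten_formE.
rewrite (metricC symG b a Ux) [pd b u x * _]mulrC.
have /matrixP/(_ a b) := hess_sym oU symG su Ux; rewrite mxE => ->.
suff /matrixP/(_ a b) : (\matrix_(k, l) fibre_metric_deriv G al x k l)^T
    = \matrix_(k, l) fibre_metric_deriv G al x k l by rewrite !mxE => ->.
rewrite fibre_metric_derivE// trmx_mul symG// -curve_deriv_tr -curve_derivMl.
  rewrite -curve_derivMr; last by move=> c d; exact: derivable_family.
  by congr curve_deriv; apply/funext => r; rewrite adj.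
by move=> c d; under eq_fun do rewrite mxE; exact: derivable_family.
Qed.

(** Tracing with [G] gives [scal/(2(n-1)) - Lap u - (n/2 - 1) |grad u|^2], which is [1/(2(n-1))]
    times the bracket in [scalar_curvature_conformal]; both sides carry the same factor
    [e^{-2u}]. *)
Lemma weingarten_form_trace x : n%:R - 1 != 0 :> R -> U x ->
  \tr (curve_deriv (al ^~ x)) = scalar_curvature G x / (n%:R - 1) ->
  trace_wrt Gu x (weingarten_form G al u x)
  = scalar_curvature Gu x / (2 * (n%:R - 1)).
Proof.
move=> n1 Ux tral; rewrite (scalar_curvature_conformal oU sG symG unitG su Ux).
rewrite (trace_conformal u unitG)// /weingarten_form.
rewrite !(trace_wrtD, trace_wrtN, trace_wrtZ) (trace_metric unitG)//.
rewrite (trace_du_du u symG unitG)// -/(laplacian G u x).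
(* The trace is cyclic, so the metric and its inverse cancel and the trace of the derivative of the
   family is left. *)
have -> : trace_wrt G x (\matrix_(k, l) fibre_metric_deriv G al x k l)
    = scalar_curvature G x / (n%:R - 1).
  rewrite fibre_metric_derivE// /trace_wrt mxtrace_mulC -mulmxA mulmxV ?unitG//.
  by rewrite mulmx1.
move: (expR _) (scalar_curvature G x) (sqnorm _ _ _) (laplacian _ _ _) n1.
by move: (n%:R : R) => N e s q l n1; field.
Qed.

(** A cocycle identity. On the left, polarization produces [<du, dv> G] and the two mixed products
    of [du] and [dv]; on the right, the same terms are the difference between the Hessians of [v]
    for [Gu] and for [G]. *)
Lemma weingarten_form_conformal v x : smooth_on U v -> U x ->
  weingarten_form G al (fun y => u y + v y) x
  = weingarten_form G al u x - (sqnorm Gu x (grad Gu v x) / 2) *: Gu x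
    - hess Gu v x + (dfun v x)^T *m dfun v x.
Proof.
move=> sv Ux.
(* The squared gradient times the metric is conformally invariant. *)
have sqE : sqnorm Gu x (grad Gu v x) * expR (2 * u x) = sqnorm G x (grad G v x).
  have unitGu : forall y, U y -> Gu y \in unitmx := conformal_unit u unitG.
  have symGu y : U y -> (Gu y)^T = Gu y by move=> Uy; rewrite linearZ /= symG.
  rewrite (sqnorm_gradE symG unitG)// (sqnorm_gradE symGu unitGu)// mulr_suml.
  apply: eq_bigr => k _; rewrite !gradE -mulrA mulr_suml; congr (_ * _).
  apply: eq_bigr => l _; rewrite (invmx_conformal u unitG)// mxE expRN.
  by have := expR_neq0 (2 * u x); move: (expR _) (invmx _ _ _) (pd _ _ _) => e i p e0; field.
apply/matrixP => a b.
have entries (A B : 'M[R]_n) s : (A - s *: Gu x - B + (dfun v x)^T *m dfun v x) a b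
    = A a b - s * (expR (2 * u x) * G x a b) - B a b + pd a v x * pd b v x.
  by rewrite !mxE big_ord1 !mxE.
have pduv k : pd k (fun y => u y + v y) x = pd k u x + pd k v x.
  exact: pdD (smooth_differentiable su Ux) (smooth_differentiable sv Ux).
have hess_uv : hess G (fun y => u y + v y) x a b = hess G u x a b + hess G v x a b.
  by have := hess_add G oU su sv Ux; move=> /matrixP/(_ a b) ->; rewrite [LHS]mxE.
have hess_Gu : hess Gu v x a b = hess G v x a b
    - (pd a u x * pd b v x + pd a v x * pd b u x)
    + (\sum_k pd k v x * grad G u x 0 k) * G x a b.
  rewrite (hess_conformal sG symG unitG su v Ux).
  by move: (hess G v x) (\sum_k _) => h s; rewrite !mxE !big_ord1 !mxE.
rewrite [RHS]entries [LHS]weingarten_formE.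
rewrite [X in _ = X - _ - _ + _]weingarten_formE hess_uv hess_Gu !pduv.
have := sqnorm_grad_add symG unitG su sv Ux; rewrite -sqE => ->.
move: (sqnorm _ _ _) (sqnorm _ _ _) (\sum_k _) (fibre_metric_deriv _ _ _ _ _).
move: (hess _ _ _ _ _) (hess _ _ _ _ _) (G x a b) (expR _).
by move: (pd a u x) (pd b u x) (pd a v x) (pd b v x) => *; field.
Qed.

End LocalMoebius.

Section FormCoordinateChange.
Context {R : realType} {n : nat}.
Variables (W V : set 'rV[R]_n) (phi : 'rV[R]_n -> 'rV[R]_n).
Variables (G H : 'rV[R]_n -> 'M[R]_n) (al be : R -> 'rV[R]_n -> 'M[R]_n).
Variables (u v : 'rV[R]_n -> R).
Hypotheses (oW : open W) (phiWV : forall x, W x -> V (phi x)).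
Hypothesis sphi : smooth_mx_on W phi.
Hypothesis sH : smooth_mx_on V H.
Hypothesis symG : forall x, W x -> (G x)^T = G x.
Hypothesis symH : forall x, V x -> (H x)^T = H x.
Hypothesis unitG : forall x, W x -> G x \in unitmx.
Hypothesis unitH : forall x, V x -> H x \in unitmx.
Hypothesis sv : smooth_on V v.
Hypothesis GE : forall x, W x -> G x = 'J phi x *m H (phi x) *m ('J phi x)^T.
Hypothesis uE : forall x, W x -> u x = v (phi x).
Hypothesis sal : smooth_mx_on [set z : 'rV[R]_(1 + n) | W (rsubmx z)]
  (fun z => al (lsubmx z 0 0) (rsubmx z)).
Hypothesis sbe : smooth_mx_on [set z : 'rV[R]_(1 + n) | V (rsubmx z)]
  (fun z => be (lsubmx z 0 0) (rsubmx z)).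
Hypothesis alE : forall r x, W x -> al r x *m 'J phi x = 'J phi x *m be r (phi x).

(** Each of the four terms transforms as a tensor; for the first one the relation [alE] is
    differentiated in the parameter, where the Jacobian is constant. *)
Lemma weingarten_form_coordinate_change x : W x ->
  weingarten_form G al u x
  = 'J phi x *m weingarten_form H be v (phi x) *m ('J phi x)^T.
Proof.
move=> Wx; have Vx := phiWV Wx; rewrite /weingarten_form.
rewrite (sqnorm_coordinate_change oW phiWV sphi unitG unitH sv GE uE Wx).
rewrite (hess_coordinate_change oW phiWV sphi sH symG symH unitG unitH sv GE uE Wx).
rewrite (dfun_coordinate_change oW phiWV sphi sv uE Wx).
rewrite (fibre_metric_derivE G sal Wx) (fibre_metric_derivE H sbe Vx).
have -> : curve_deriv (al ^~ x) *m G x = 'J phi x *m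
    (curve_deriv (be ^~ (phi x)) *m H (phi x)) *m ('J phi x)^T.
  rewrite (GE Wx) !mulmxA; congr (_ *m _ *m _).
  rewrite -curve_derivMr; last by move=> a b; exact: (@derivable_family _ _ _ _ sal _ a b Wx).
  rewrite -curve_derivMl; last by move=> a b; exact: (@derivable_family _ _ _ _ sbe _ a b Vx).
  by congr curve_deriv; apply/funext => r; rewrite alE.
rewrite !mulmxDr !mulmxDl !mulmxN !mulNmx -!scalemxAr -!scalemxAl -(GE Wx).
by rewrite trmx_mul trmxK !mulmxA.
Qed.

End FormCoordinateChange.

(** * Globalization *)

Section ManifoldCharts.
Context {R : realType} {T : topologicalType} {n : nat} {I : Type}.
Variable A : I -> chart R T n.
Hypothesis mfd : smooth_manifold A.

Lemma crd_par i x : cran (A i) x -> crd (A i) (par (A i) x) = x.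
Proof. by move=> [p dp <-]; rewrite (mfd_crdK mfd dp). Qed.

Lemma dom_par i x : cran (A i) x -> dom (A i) (par (A i) x).
Proof. by move=> [p dp <-]; rewrite (mfd_crdK mfd dp). Qed.

Lemma cran_crd i p : dom (A i) p -> cran (A i) (crd (A i) p).
Proof. by move=> dp; exists p. Qed.

Lemma transition_cran i j x : overlap A i j x -> cran (A j) (transition A i j x).
Proof. by move=> [_]; exact: cran_crd. Qed.

Lemma par_transition i j x : overlap A i j x ->
  par (A j) (transition A i j x) = par (A i) x.
Proof. by move=> [_] dx; rewrite /transition (mfd_crdK mfd dx). Qed.

(** The overlap is the preimage of an open chart domain under [par], which is continuous on the open
    range of the chart. *)
Lemma overlap_open i j : open (overlap A i j).
Proof.
rewrite openE => x [cx dx].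
have oc := @mfd_cran_open _ _ _ _ _ mfd i.
have := @mfd_par_cont _ _ _ _ _ mfd i; rewrite continuous_open_subspace// => /(_ x).
rewrite inE => /(_ cx) parc.
have dn : nbhs (par (A i) x) (dom (A j)).
  by apply: open_nbhs_nbhs; split => //; exact: mfd_dom_open.
have cn : nbhs x (cran (A i)) by apply: open_nbhs_nbhs.
by have pn := parc _ dn; apply: filterS (filterI cn pn) => y [].
Qed.

End ManifoldCharts.

Lemma posdef_unit (R : realType) n (S : 'M[R]_n) :
  (forall v : 'rV[R]_n, v != 0 -> 0 < (v *m S *m v^T) 0 0) -> S \in unitmx.
Proof.
move=> pos; rewrite -row_free_unit; apply: inj_row_free => v vS.
by apply/eqP; apply: contraT => /pos; rewrite vS mul0mx mxE ltxx.
Qed.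

Section ConformalClass.
Context {R : realType} {T : topologicalType} {n : nat} {I : Type}.
Variable A : I -> chart R T n.
Hypothesis mfd : smooth_manifold A.

Lemma smooth_fun_add (u v : T -> R) : smooth_fun A u -> smooth_fun A v ->
  smooth_fun A (fun p => u p + v p).
Proof. by move=> su sv i; apply: smoothD => //; exact: mfd_cran_open. Qed.

Lemma smooth_fun_opp (u : T -> R) : smooth_fun A u -> smooth_fun A (fun p => - u p).
Proof. by move=> su i; apply: smoothN => //; exact: mfd_cran_open. Qed.

Lemma conf_conf (g : tfield R n I) u v :
  conf A (conf A g u) v = conf A g (fun p => u p + v p).
Proof.
apply/funext => i; apply/funext => x; rewrite /conf scalerA -expRD.
by congr (expR _ *: _); rewrite /loc; ring.
Qed.

Lemma conf_metric (g : tfield R n I) u : riemannian_metric A g -> smooth_fun A u ->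
  riemannian_metric A (conf A g u).
Proof.
move=> [[[sg zg] tg] symg posg] su; split; [split; [split|]| |].
- move=> i; have oU := @mfd_cran_open _ _ _ _ _ mfd i; apply: smooth_mxZ => //.
  by apply: smooth_expR => //; apply: smoothM => //; exact: smooth_cst.
- by move=> i x cx; rewrite /conf zg// scaler0.
- move=> i j x Ox; rewrite /conf (tg i j x Ox) /loc (par_transition mfd Ox).
  by rewrite -scalemxAr -scalemxAl.
- by move=> i x cx; rewrite /conf linearZ /= symg.
- move=> i x cx v v0; rewrite /conf -scalemxAr -scalemxAl mxE.
  by rewrite mulr_gt0 ?expR_gt0 ?posg.
Qed.

(** Moves the base point of the class from the metric that defines it to [g]: if [g] has exponent
    [w], exponents are shifted by [w]. *)
Lemma conformal_structure_conf (c : set (tfield R n I)) g :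
  conformal_structure A c -> c g -> riemannian_metric A g /\
  forall h, c h <-> exists2 u, smooth_fun A u & h = conf A g u.
Proof.
move=> [g0 rg0 ->] [w sw ->]; split; first exact: conf_metric.
move=> h; split=> [[u su ->]|[u su ->]].
  exists (fun p => - w p + u p).
    by apply: smooth_fun_add => //; exact: smooth_fun_opp.
  rewrite conf_conf; congr conf; apply/funext => p.
  by rewrite addrA subrr add0r.
exists (fun p => w p + u p); first exact: smooth_fun_add.
by rewrite conf_conf.
Qed.

(** A nonzero tangent vector, available because [0 < n], shows that the matrix of [g] is not zero,
    so the scalar factor can be read off. This makes [D] single-valued. *)
Lemma conf_inj (g : tfield R n I) u v : (0 < n)%N -> riemannian_metric A g ->
  conf A g u = conf A g v -> u = v.
Proof.
move=> n0 [_ _ posg] E; apply/funext => p.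
have [i dp] := mfd_cover mfd p; pose x := crd (A i) p.
have cx : cran (A i) x := cran_crd dp.
have := congr1 (fun h : tfield R n I => h i x) E.
rewrite /conf /loc (mfd_crdK mfd dp) => /eqP.
rewrite -subr_eq0 -scalerBl scaler_eq0 => /orP[|/eqP g0].
  by rewrite subr_eq0 => /eqP /expR_inj /mulfI -> //; rewrite pnatr_eq0.
have e0 : (delta_mx 0 (Ordinal n0) : 'rV[R]_n) != 0.
  by apply/eqP => /matrixP/(_ 0 (Ordinal n0)); rewrite !mxE !eqxx => /eqP; rewrite oner_eq0.
by have := posg i x cx _ e0; rewrite g0 mulmx0 mul0mx mxE ltxx.
Qed.

End ConformalClass.

Section CovariantDerivativeComposition.
Context {R : realType} {k m n : nat}.
Variables (Gt : 'rV[R]_n -> 'M[R]_n) (phi : 'rV[R]_k -> 'rV[R]_m).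
Variables (F v : 'rV[R]_m -> 'rV[R]_n) (F' v' : 'rV[R]_k -> 'rV[R]_n) (x : 'rV[R]_k).
Hypotheses (dphi : differentiable phi x).
Hypotheses (dF : differentiable F (phi x)) (dv : differentiable v (phi x)).
Hypothesis FE : \near x, F (phi x) = F' x.
Hypothesis vE : \near x, v (phi x) = v' x.

Let jacobian_comp_near (f : 'rV[R]_m -> 'rV[R]_n) f' :
  differentiable f (phi x) -> (\near x, f (phi x) = f' x) ->
  'J f' x = 'J phi x *m 'J f (phi x).
Proof.
move=> df fE; rewrite -(jacobian_comp dphi df); symmetry.
apply: (near_eq_jacobian fE).
exact: (@differentiable_comp _ _ _ _ phi f).
Qed.

Lemma jacobian_along_comp : 'J F' x = 'J phi x *m 'J F (phi x).
Proof. exact: jacobian_comp_near. Qed.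

(** The map and the field enter the induced connection through their values and Jacobians at the
    point, so the chain rule suffices. Equality near [x] is assumed because the coordinate
    expressions agree only on an overlap. *)
Lemma cov_deriv_comp w :
  cov_deriv Gt F' v' x w = cov_deriv Gt F v (phi x) (w *m 'J phi x).
Proof.
have Fx : F' x = F (phi x) by rewrite (nbhs_singleton FE).
have vx : v' x = v (phi x) by rewrite (nbhs_singleton vE).
rewrite /cov_deriv; congr (_ + _).
  by rewrite -mulmxA; congr (_ *m _); exact: jacobian_comp_near.
apply/rowP => l; rewrite [LHS]mxE [RHS]mxE.
apply: eq_bigr => a _; apply: eq_bigr => b _; rewrite Fx vx -mulmxA.
by congr (_ * (_ *m _) 0 a * _); exact: jacobian_along_comp.
Qed.

End CovariantDerivativeComposition.

(** * The Weingarten form as a tensor field, and the solution of the Weingarten equation *)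

Section MoebiusFromWeingarten.
Context {R : realType} {T : topologicalType} {n : nat} {I : Type}.
Variable A : I -> chart R T n.
Hypothesis mfd : smooth_manifold A.
Variable g : tfield R n I.
Hypothesis g_metric : riemannian_metric A g.
Variable alpha : R -> tfield R n I.
Hypothesis alpha_smooth : smooth_family A alpha.
Hypothesis alpha_id : forall i x, cran (A i) x -> alpha 0 i x = 1%:M.

Let al i : R -> 'rV[R]_n -> 'M[R]_n := fun r => alpha r i.

Let oU i : open (cran (A i)) := @mfd_cran_open _ _ _ _ _ mfd i.
Let oW i j : open (overlap A i j) := @overlap_open _ _ _ _ _ mfd i j.
Let sg i : smooth_mx_on (cran (A i)) (g i).
Proof. by have [[[sg _] _] _ _] := g_metric; exact: sg. Qed.
Let symg i x : cran (A i) x -> (g i x)^T = g i x.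
Proof. by have [_ symg _] := g_metric; exact: symg. Qed.
Let unitg i x : cran (A i) x -> g i x \in unitmx.
Proof. by have [_ _ posg] := g_metric => cx; exact/posdef_unit/posg. Qed.
Let sal i : smooth_mx_on [set z : 'rV[R]_(1 + n) | cran (A i) (rsubmx z)]
  (fun z => al i (lsubmx z 0 0) (rsubmx z)).
Proof. by have [_ s] := alpha_smooth; exact: s. Qed.

Let loc_transition (u : T -> R) i j x : overlap A i j x ->
  loc A u i x = loc A u j (transition A i j x).
Proof. by move=> Ox; rewrite /loc (par_transition mfd Ox). Qed.

Definition moebius_field (u : T -> R) : tfield R n I := fun i x =>
  if `[< cran (A i) x >] then weingarten_form (g i) (al i) (loc A u i) x else 0.

Lemma moebius_fieldE u i x : cran (A i) x ->
  moebius_field u i x = weingarten_form (g i) (al i) (loc A u i) x.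
Proof. by move=> cx; rewrite /moebius_field asboolT. Qed.

Lemma moebius_field_tensor u : smooth_fun A u -> tensor02 A (moebius_field u).
Proof.
move=> su; split; [split|].
- move=> i.
  have sw := smooth_weingarten_form (@oU i) (@sg i) (@unitg i) (@sal i) (su i).
  apply: (eq_smooth_mx_on (@oU i) _ sw) => x cx.
  by rewrite moebius_fieldE.
- by move=> i x cx; rewrite /moebius_field asboolF.
- move=> i j x Ox; rewrite !moebius_fieldE; last 2 first.
  + exact: transition_cran.
  + by case: Ox.
  have sub : overlap A i j `<=` cran (A i) by move=> y [].
  have [_ tg] : tensor02 A g by have [] := g_metric.
  have [tal _] := alpha_smooth.
  apply: (weingarten_form_coordinate_change (@oW i j) (@transition_cran _ _ _ _ A i j)
    (mfd_transition mfd i j) (@sg j) _ (@symg j) _ (@unitg j) (su j) (tg i j)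
    (@loc_transition u i j) _ (@sal j)) => //.
  + by move=> y /sub; exact: symg.
  + by move=> y /sub; exact: unitg.
  + by move=> a b; apply: (sub_smooth_on _ (@sal i a b)) => z /=; exact: sub.
  + by move=> r y Oy; have [_ ta] := tal r; exact: ta.
Qed.

(** The candidate for the Weingarten endomorphism: an index of the form is raised with the induced
    metric. *)
Definition weingarten_field (u : T -> R) : tfield R n I := fun i x =>
  if `[< cran (A i) x >] then moebius_field u i x *m invmx (conf A g u i x) else 0.

Lemma lower_weingarten_field u : smooth_fun A u ->
  moebius_field u = lower (conf A g u) (weingarten_field u).
Proof.
move=> su; have [_ _ posh] := conf_metric mfd g_metric su.
apply/funext => i; apply/funext => x; rewrite /lower /weingarten_field.
case: asboolP => cx; last by rewrite /moebius_field asboolF// mul0mx.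
by rewrite mulmxKV//; exact/posdef_unit/posh.
Qed.

(** The mixed transformation law follows from those of the form and of the metric [e^{2u} g], after
    cancelling the invertible factor [K]. *)
Lemma weingarten_field_tensor u : smooth_fun A u -> tensor11 A (weingarten_field u).
Proof.
move=> su; have [[[sh _] th] symh posh] := conf_metric mfd g_metric su.
have unith i x : cran (A i) x -> conf A g u i x \in unitmx.
  by move=> cx; exact/posdef_unit/posh.
have [[sD _] tD] := moebius_field_tensor su.
split; [split|].
- move=> i; apply: (eq_smooth_mx_on (@oU i) (F := fun x =>
    moebius_field u i x *m invmx (conf A g u i x))).
    by move=> x cx; rewrite /weingarten_field asboolT.
  have sI := smooth_invmx (@oU i) (@unith i) (sh i).
  exact: (smooth_mxM (@oU i) (sD i) sI).
- by move=> i x cx; rewrite /weingarten_field asboolF.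
- move=> i j x Ox; have ci : cran (A i) x by case: Ox.
  have cj := transition_cran Ox.
  have DB k y : weingarten_field u k y *m conf A g u k y = moebius_field u k y.
    by rewrite [RHS](_ : _ = lower (conf A g u) (weingarten_field u) k y) ?lower_weingarten_field.
  have hE := th i j x Ox.
  pose K := conf A g u j (transition A i j x) *m ('J (transition A i j) x)^T.
  have K1 : K \in unitmx.
    by have := unith i x ci; rewrite hE -mulmxA unitmx_mul => /andP[].
  apply: (can_inj (mulmxK K1)); rewrite /K !mulmxA.
  rewrite -[in LHS]mulmxA -[in LHS]mulmxA [X in _ *m X](_ : _ = conf A g u i x); last first.
    by rewrite hE mulmxA.
  by rewrite DB (tD i j x Ox) -[in RHS](mulmxA _ (weingarten_field _ _ _)) DB.
Qed.

Section Immersion.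
Variables (u : T -> R) (delta : R) (i j : I).
Hypothesis su : smooth_fun A u.

Local Notation phi := (transition A i j).
Local Notation Fij := (fun z => crd (amb_chart A delta j) (Psi u (par (A i) z))).
Local Notation etaij := (fun z => eta A g u j (par (A i) z)).

Let Fij_near x : overlap A i j x ->
  \near x, psi_loc (loc A u j) (phi x) = Fij x.
Proof.
move=> Ox; apply: filterS (open_nbhs_nbhs (conj (@oW i j) Ox)) => z Oz.
by rewrite /psi_loc -loc_transition.
Qed.

Let etaij_near x : overlap A i j x ->
  \near x, eta_loc (g j) (loc A u j) (phi x) = etaij x.
Proof.
move=> Ox; apply: filterS (open_nbhs_nbhs (conj (@oW i j) Ox)) => z Oz.
by rewrite /eta_loc -loc_transition.
Qed.

(** Measures how far an arbitrary endomorphism is from solving the Weingarten equation, tested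
    against tangent vectors: the defect is its lowered form minus the expected one, both pulled back
    to chart [i]. Existence reads it as zero, uniqueness reads the difference off from it. *)
Lemma tangential_defect x (b b' : 'M[R]_n) (w w' : 'rV[R]_n) : overlap A i j x ->
  b *m 'J phi x = 'J phi x *m b' ->
  (cov_deriv (amb_metric g alpha j) Fij etaij x w - - (w *m b *m 'J Fij x))
    *m amb_metric g alpha j (Fij x) *m (w' *m 'J Fij x)^T
  = w *m 'J phi x *m (b' *m conf A g u j (phi x) - moebius_field u j (phi x))
    *m (w' *m 'J phi x)^T.
Proof.
move=> Ox bJ; have cj := transition_cran Ox.
have dphi : differentiable phi x := smooth_mx_differentiable (mfd_transition mfd i j) Ox.
have dF := differentiable_psi (su j) cj.
have dv := differentiable_eta (@oU j) (@sg j) (@unitg j) (su j) cj.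
have gtE : amb_metric g alpha j = ambient (g j) (al j) by [].
rewrite gtE (cov_deriv_comp _ dphi dF dv (Fij_near Ox) (etaij_near Ox)).
rewrite (jacobian_along_comp dphi dF (Fij_near Ox)) -(nbhs_singleton (Fij_near Ox)).
rewrite cov_derivE opprK.
have W0 := ambient_weingarten (@oU j) (@sg j) (@symg j) (@unitg j) (@sal j)
  (@alpha_id j) (su j) cj.
have W1 := first_fundamental_form (al := al j) (g j) (@alpha_id j) (su j) cj.
have -> : w *m b *m ('J phi x *m 'J (psi_loc (loc A u j)) (phi x))
    = w *m 'J phi x *m (b' *m 'J (psi_loc (loc A u j)) (phi x)).
  by rewrite !mulmxA -(mulmxA w b) bJ !mulmxA.
rewrite -mulmxDr mulmxA trmx_mul mulmxA; congr (_ *m _).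
rewrite -!(mulmxA (w *m 'J phi x)); congr (_ *m _).
rewrite mulmxDl mulmxDl W0 -!(mulmxA b') W1.
by rewrite addrC moebius_fieldE.
Qed.

End Immersion.

Lemma weingarten_field_is_weingarten u delta : 0 < delta -> smooth_fun A u ->
  is_weingarten A (amb_chart A delta) (amb_metric g alpha) (Psi u) (eta A g u)
    (weingarten_field u).
Proof.
move=> d0 su; have tB := weingarten_field_tensor su; split=> // i j x cx [_ _ dj].
move=> Fij etaij w; have Ox : overlap A i j x by [].
split; first by rewrite -mulNmx submxMl.
move=> w'; apply: (etrans (tangential_defect delta su w w' Ox (tB.2 i j x Ox))).
have -> : moebius_field u j (transition A i j x) =
    weingarten_field u j (transition A i j x) *m conf A g u j (transition A i j x).
  by rewrite lower_weingarten_field.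
by rewrite subrr mulmx0 mul0mx.
Qed.

(** Uniqueness: a single chart used on both sides already determines [B], and the tensor condition
    makes both fields vanish outside the coordinate range. *)
Lemma is_weingarten_lower u delta B : 0 < delta -> smooth_fun A u ->
  is_weingarten A (amb_chart A delta) (amb_metric g alpha) (Psi u) (eta A g u) B ->
  lower (conf A g u) B = moebius_field u.
Proof.
move=> d0 su [[[_ zB] tB] HB]; apply/funext => i; apply/funext => x.
have [cx|ncx] := pselect (cran (A i) x); last first.
  by rewrite /lower zB// mul0mx /moebius_field asboolF.
have Ox : overlap A i i x by split => //; exact: dom_par.
have phix : transition A i i x = x := crd_par mfd cx.
(* The image has [rho = 0], which lies in the chart since [delta] is positive. *)
have dx : dom (amb_chart A delta i) (Psi u (par (A i) x)).
  by split; [exact: expR_gt0 | rewrite /= oppr_lt0 d0 | exact: dom_par].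
(* Invertibility is all that is used of this Jacobian, and the transformation law of [g] gives it
   without computing the Jacobian. *)
have J1 : 'J (transition A i i) x \in unitmx.
  have [[_ tg] _ _] := g_metric; have := unitg cx.
  by rewrite (tg i i x Ox) -mulmxA unitmx_mul => /andP[].
set J := 'J (transition A i i) x in J1.
apply/eqP; rewrite -subr_eq0; apply/eqP/matrixP => a b.
(* These test vectors are mapped by [J] to basis vectors, so the defect is exactly the entry
   [(a, b)]. *)
have [_ /(_ (delta_mx 0 b *m invmx J))] := HB i i x cx dx (delta_mx 0 a *m invmx J).
rewrite (tangential_defect _ su _ _ Ox (tB i i x Ox)) phix !(mulmxKV J1).
move=> /matrixP/(_ 0 0); rewrite [RHS]mxE -rowE => E; rewrite [RHS]mxE -[RHS]E.
by rewrite trmx_delta -colE !mxE.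
Qed.

End MoebiusFromWeingarten.

Theorem theorem4p5 (R : realType) (n : nat) (n_ge2 : (2 <= n)%N)
    (T : topologicalType) (I : Type) (A : I -> chart R T n)
    (M_mfd : smooth_manifold A)
    (c : set (tfield R n I)) (c_conf : conformal_structure A c)
    (g : tfield R n I) (g_in_c : c g)
    (alpha : R -> tfield R n I) (alpha_adm : admissible A c alpha)
    (alpha_trace : forall i x, cran (A i) x ->
       \tr (family_deriv alpha 0 i x)
       = scalar_curvature (g i) x / (n%:R - 1))
    (delta : R) (delta_gt0 : 0 < delta)
    (alpha_nonsing : nonsingular_below A alpha delta) :
  exists D : tfield R n I -> tfield R n I,
    (forall h S, c h ->
       (weingarten_assignment A g alpha delta h S <-> S = D h)) /\
    moebius_structure A c D.
Proof.
have [g_metric cE] := conformal_structure_conf M_mfd c_conf g_in_c.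
have alpha_smooth := adm_smooth alpha_adm.
have alpha_id := adm_id alpha_adm.
have alpha_adj r i x (cx : cran (A i) x) := adm_selfadj alpha_adm r g_in_c cx.
have n_gt0 : (0 < n)%N := ltnW n_ge2.
have oU i : open (cran (A i)) := @mfd_cran_open _ _ _ _ _ M_mfd i.
have [[[sg _] _] symg posg] := g_metric.
have unitg i x (cx : cran (A i) x) : g i x \in unitmx := posdef_unit (posg i x cx).
have [_ sal] := alpha_smooth.
pose Q := moebius_field A g alpha.
(* The exponent of [h] is picked by choice and is unique by [conf_inj]; off the class the value [h]
   is an arbitrary default. *)
pose D h := if pselect (exists2 u, smooth_fun A u & h = conf A g u) is left H
  then Q (projT1 (cid2 H)) else h.
have DE u : smooth_fun A u -> D (conf A g u) = Q u.
  move=> su; rewrite /D; case: pselect => [H|]; last by case; exists u.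
  case: (cid2 H) => /= v sv; move=> /(conf_inj M_mfd n_gt0 g_metric) uv.
  by rewrite uv.
exists D; split.
  move=> h S /cE[u su hE]; split=> [[v [B [sv hv wB ->]]]|->].
    rewrite hv DE//.
    exact: (is_weingarten_lower M_mfd g_metric alpha_smooth alpha_id delta_gt0 sv wB).
  exists u, (weingarten_field A g alpha u); split=> //.
    exact: weingarten_field_is_weingarten.
  by rewrite hE DE// -lower_weingarten_field.
split.
- move=> h /cE[u su ->]; rewrite DE//.
  exact: moebius_field_tensor.
- move=> h /cE[u su ->] i x cx; rewrite DE// /Q moebius_fieldE//.
  apply: (weingarten_form_sym (oU i) (symg i) (sal i) (su i)) => // r.
  exact: alpha_adj.
- move=> h /cE[u su ->] i x cx; rewrite DE// /Q moebius_fieldE//.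
  apply: (weingarten_form_trace (oU i) (sg i) (symg i) (unitg i) (sal i) (su i)) => //.
    (* Dimension at least two keeps the denominator [n - 1] away from zero. *)
    by rewrite subr_eq0 pnatr_eq1 gtn_eqF.
  exact: alpha_trace.
(* Rescaling [e^{2u} g] by [e^{2v}] is rescaling [g] by [e^{2(u+v)}], so both sides are values of
   the same form. *)
- move=> h v /cE[u su ->] sv i x cx vi; rewrite (conf_conf A g u v) !DE//; last first.
    exact: smooth_fun_add.
  rewrite /Q !moebius_fieldE//.
  exact: (weingarten_form_conformal _ (oU i) (sg i) (symg i) (unitg i) (su i) (sv i) cx).
Qed.
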